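(* Let $d\ge 2$ and let $p=(p_1,\dots,p_d)$ be a probability vector with $p_j\ne1$ for all $j$. Let $c_n$ be the number of collisions of SICTA started with $n$ packets with splitting probabilities $p$, and let $C_n=\mathbb{E}[c_n]$. Then the exponential moment generating function $\widetilde{R}(x,z)=\sum_{n\ge 0}\frac{x^n}{n!}\mathbb{E}[z^{c_n}]$ satisfies (for all $x,z\in\mathbb{C}$ for which the expectations and series converge absolutely, in particular for $|z|\le 1$) $$\widetilde{R}(x,z)=(1+x)(1-z)+(z-1)(xp_d+1)\prod_{i=1}^{d-1}\widetilde{R}(p_ix,z)+\prod_{j=1}^d \widetilde{R}(p_jx,z),$$ and for all $n\ge0$ $$C_n=\sum_{i=2}^n\binom{n}{i}\frac{(-1)^i(i-1)(1-p_d^i)}{1-\sum_{j=1}^d p_j^i}.$$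
   Context: Definition of $c_n$. For $n\ge 2$ let $(I_1,\dots,I_d)$ be multinomially distributed with $n$ trials and cell probabilities $p$, and let $M=\inf\{k\in\{1,\dots,d\}: \sum_{j=1}^k I_j\ge n-1\}$. The laws of the (almost surely finite, nonnegative integer valued) random variables $c_n$ are determined recursively by $c_0=c_1=0$ and, for $n\ge 2$, by the distributional identity $$c_n=\mathbf{1}\{M<d\}+\sum_{j=1}^{M} c_{I_j},$$ where, given $(I_1,\dots,I_d)$, the variables $c_{I_1},\dots,c_{I_d}$ on the right are independent, $c_{I_j}$ having the law of $c_m$ with $m=I_j$. *)

(* Defs.v *)
From HB Require Import structures.
From mathcomp Require Import all_boot all_order all_algebra.
From mathcomp Require Import all_classical all_reals all_analysis.
From mathcomp Require Import complex.

Set Implicit Arguments.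
Unset Strict Implicit.
Unset Printing Implicit Defensive.
Import Order.TTheory GRing.Theory Num.Theory.
Import numFieldNormedType.Exports.
Local Open Scope classical_set_scope.
Local Open Scope ring_scope.
Local Open Scope complex_scope.

(* The cells 1, ..., d are indexed by 'I_d, i.e. shifted to 0, ..., d.-1; the
   first k cells are the j : 'I_d with j < k. *)

Section Sicta.
Context (R : realType) (d : nat).

Definition multinomial_pmf (p : 'I_d -> R) (n : nat) (i : 'I_d -> nat) : R :=
  if (\sum_j i j == n)%N then
    n`!%:R / (\prod_j (i j)`!)%:R * \prod_j p j ^+ i j
  else 0.

(* M = inf {k in {1, ..., d} : i_1 + ... + i_k >= n - 1}; the default value d
   of the minimum is harmless, as k = d belongs to the set if i_1 + ... + i_d = n. *)
Definition stop_index (n : nat) (i : 'I_d -> nat) : nat :=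
  \big[minn/d]_(1 <= k < d.+1 | (n.-1 <= \sum_(j < d | j < k) i j)%N) k.

Definition collision_sum (n : nat) (i x : 'I_d -> nat) : nat :=
  ((stop_index n i < d) + \sum_(j < d | j < stop_index n i) x j)%N.

Context (disp : measure_display) (T : measurableType disp).
Context (P : probability T R).

(* The distributional identity for c_n, n >= 2, realized on some auxiliary
   probability space (O, Q): I is multinomial(n, p) and, given I = i, the X_j are
   independent with the laws of the c_(i_j).  Nothing is assumed on the
   joint law of the c_n. *)
Definition collision_identity (p : 'I_d -> R) (c : nat -> {RV P >-> nat})
    (n : nat) : Prop :=
  exists (dO : measure_display) (O : measurableType dO) (Q : probability O R)
         (I X : 'I_d -> {RV Q >-> nat}),
  [/\ forall i : 'I_d -> nat,
        Q [set w | forall j, I j w = i j] = (multinomial_pmf p n i)%:E,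
      forall i x : 'I_d -> nat,
        Q [set w | forall j, I j w = i j /\ X j w = x j] =
        (Q [set w | forall j, I j w = i j] *
         \prod_(j < d) distribution P (c (i j)) [set x j])%E
    & distribution P (c n) =1
        pushforward Q (fun w => collision_sum n (I ^~ w) (X ^~ w))].

Definition sicta_collisions (p : 'I_d -> R) (c : nat -> {RV P >-> nat}) : Prop :=
  [/\ {ae P, forall t, c 0%N t = 0%N},
      {ae P, forall t, c 1%N t = 0%N}
    & forall n, (2 <= n)%N -> collision_identity p c n].

Definition expectationC (Z : T -> R[i]) : R[i] :=
  (\int[P]_t complex.Re (Z t)) +i* (\int[P]_t complex.Im (Z t)).

Definition Rtilde_term (c : nat -> {RV P >-> nat}) (x z : R[i]) :
    nat -> R[i]^o :=
  fun n => x ^+ n / n`!%:R * expectationC (fun t => z ^+ c n t).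

Definition Rtilde (c : nat -> {RV P >-> nat}) (x z : R[i]) : R[i] :=
  limn (series (Rtilde_term c x z)).

Definition Rtilde_abs_cvg (c : nat -> {RV P >-> nat}) (x z : R[i]) : Prop :=
  (forall n, P.-integrable [set: T]
               (fun t => (ComplexField.Normc.normc (z ^+ c n t))%:E)) /\
  cvgn (series (fun n => ComplexField.Normc.normc (Rtilde_term c x z n))).

End Sicta.

(* Main.v *)
Require Import Defs.
From mathcomp Require Import all_boot all_order all_algebra.
From mathcomp Require Import all_classical all_reals all_analysis.
From mathcomp Require Import measurable_realfun.
From mathcomp Require Import complex ring lra zify.

Set Implicit Arguments.
Unset Strict Implicit.
Unset Printing Implicit Defensive.
Import Order.TTheory GRing.Theory Num.Theory.
Import numFieldNormedType.Exports.
Local Open Scope classical_set_scope.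
Local Open Scope ring_scope.
Local Open Scope complex_scope.

Local Notation normc := ComplexField.Normc.normc.

(** Write e for the indicator of i_d <= 1, where
    i = (i_1, ..., i_d) is the split of n packets.  The recursion stops before
    the last cell exactly when the first d - 1 cells hold at least n - 1
    packets, that is when e = 1; and the cells it then leaves out hold at most
    one packet each, so that their collision counts vanish anyway.  The
    right-hand side of the recursion may therefore be replaced by
    e + c_(i_1) + ... + c_(i_d), with all cells present
    ([collision_sum_all_cells]).  By conditional independence the generating
    functions f_n(z) = E[z^(c_n)] satisfy, for n >= 2,
        f_n(z) = sum over i of pmf(i) * z^e * f_(i_1)(z) * ... * f_(i_d)(z)
    ([pgf_recursion]).

    Functional equation.  Since z^e = 1 + (z - 1) e, the coefficients of
    x^n / n! split into those of the Cauchy product of the d series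
    Rtilde(p_j x, z) and (z - 1) times those of the same product in which the
    last factor is cut down to its first two terms 1 + p_d x.  The cases n = 0
    and n = 1, where the recursion fails, contribute (1 + x)(1 - z)
    ([Rtilde_functional]).

    Means.  For z = 1 - h with h = 1/(r+1), the slope (1 - f_n(z)) / h is the
    expectation of 1 + z + ... + z^(c_n - 1), which increases to E[c_n] by
    monotone convergence ([cvg_slope]).  As c_n itself occurs on the right of
    the recursion, finiteness of E[c_n] has to be proved: the recursion bounds
    the slope at n by known quantities plus s_n times itself, where
    s_n = p_1^n + ... + p_d^n < 1 for n >= 2 ([slope_bounded]).  In the limit
    h -> 0 the slopes turn the product recursion into the linear one
        C_n = E[e + C_(I_1) + ... + C_(I_d)]    (n >= 2),
    whose solution with C_0 = C_1 = 0 is unique, again because s_n < 1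
    ([collision_rec_unique]).  The binomial moments
    E[binomial(I_j, i)] = binomial(n, i) p_j^i show that the closed formula
    solves it ([collision_formula_rec]). *)

(** * Cauchy products and multinomial expectations *)

(** The n-th coefficient of the product of the d power series with
    coefficients F j; an index tuple of sum n has all its entries at most n,
    whence the finite type of tuples. *)
Definition cauchy_prod (K : comNzRingType) (d : nat) (F : 'I_d -> nat -> K)
    (n : nat) : K :=
  \sum_(f : {ffun 'I_d -> 'I_n.+1} | (\sum_j f j == n)%N) \prod_j F j (f j).

Lemma coef_prod_poly (K : comNzRingType) (d : nat) (F : 'I_d -> nat -> K)
    (N n : nat) :
  (\prod_j \poly_(k < N.+1) F j k)`_n =
  \sum_(f : {ffun 'I_d -> 'I_N.+1} | (\sum_j f j == n)%N) \prod_j F j (f j).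
Proof.
under eq_bigr do rewrite poly_def.
rewrite bigA_distr_bigA /= coef_sum [RHS]big_mkcond.
apply: eq_bigr => f _.
have -> : \prod_j (F j (f j) *: 'X^(f j)) =
    (\prod_j F j (f j)) *: 'X^(\sum_j f j) :> {poly K}.
  elim/big_rec3: _ => [|j a e q _ ->]; first by rewrite scale1r expr0.
  by rewrite -scalerAl -scalerAr scalerA exprD.
rewrite coefZ coefXn eq_sym.
by case: eqP => _; rewrite ?mulr1 ?mulr0.
Qed.

(** Coefficients up to n of a product depend only on the coefficients up to n
    of the factors, so power series may be truncated to polynomials. *)
Lemma coef_prod_eq (K : comNzRingType) (I : Type) (r : seq I) (Q : pred I)
    (G H : I -> {poly K}) (n : nat) :
  (forall j k, (k <= n)%N -> (G j)`_k = (H j)`_k) ->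
  (\prod_(j <- r | Q j) G j)`_n = (\prod_(j <- r | Q j) H j)`_n.
Proof.
move=> GH.
suff: forall k, (k <= n)%N ->
    (\prod_(j <- r | Q j) G j)`_k = (\prod_(j <- r | Q j) H j)`_k by exact.
elim/big_rec2: _ => [//|j p q _ IH] k lekn.
rewrite !coefM; apply: eq_bigr => i _.
rewrite GH ?IH //; first by rewrite (leq_trans _ lekn) ?leq_subr.
by rewrite (leq_trans _ lekn) // -ltnS.
Qed.

Lemma cauchy_prodE (K : comNzRingType) (d : nat) (F : 'I_d -> nat -> K)
    (N n : nat) : (n <= N)%N ->
  cauchy_prod F n = (\prod_j \poly_(k < N.+1) F j k)`_n.
Proof.
move=> leN; rewrite /cauchy_prod -coef_prod_poly.
apply: coef_prod_eq => j k lekn; rewrite !coef_poly !ltnS lekn.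
by rewrite (leq_trans lekn leN).
Qed.

(** The product of the exponential series of the a_j is the exponential series
    of their sum; this is the multinomial theorem in disguise. *)
Lemma coef_prod_exp (K : fieldType) (I : Type) (r : seq I) (Q : pred I)
    (a : I -> K) (n : nat) : (forall k, k`!%:R != 0 :> K) ->
  (\prod_(j <- r | Q j) \poly_(k < n.+1) (a j ^+ k / k`!%:R))`_n =
  (\sum_(j <- r | Q j) a j) ^+ n / n`!%:R.
Proof.
move=> fact_neq0.
suff: forall k, (k <= n)%N ->
    (\prod_(j <- r | Q j) \poly_(k < n.+1) (a j ^+ k / k`!%:R))`_k =
    (\sum_(j <- r | Q j) a j) ^+ k / k`!%:R by exact.
elim/big_rec2: _ => [|j y p _ IH] k lekn.
  by rewrite coef1; case: k lekn => [|k] _; rewrite ?expr0 ?fact0 ?divr1 // expr0n mul0r.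
rewrite coefM addrC exprDn mulr_suml; apply: eq_bigr => -[i /=]; rewrite ltnS => leik _.
rewrite coef_poly ltnS (leq_trans leik lekn) IH; last first.
  by rewrite (leq_trans _ lekn) ?leq_subr.
rewrite -(bin_fact leik) !natrM -mulr_natr.
have b0 : 'C(k, i)%:R != 0 :> K.
  have := fact_neq0 k; rewrite -(bin_fact leik) natrM.
  by apply: contraNneq => ->; rewrite mul0r.
by field; rewrite b0 !fact_neq0.
Qed.

(** The multinomial probabilities are n! times the coefficients of a product of
    exponential series, so an expectation of a product over the cells is a
    Cauchy product.  The morphism phi lets the same statement serve real and
    complex integrands. *)
Lemma multinomial_cauchy (R : realType) (K : fieldType)
    (phi : {rmorphism R -> K}) (d : nat) (p : 'I_d -> R) (n : nat)
    (G : 'I_d -> nat -> K) :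
  \sum_(f : {ffun 'I_d -> 'I_n.+1})
     phi (multinomial_pmf p n (fun j => f j)) * \prod_j G j (f j) =
  n`!%:R * cauchy_prod (fun j k => phi (p j) ^+ k / k`!%:R * G j k) n.
Proof.
rewrite /cauchy_prod mulr_sumr [RHS]big_mkcond; apply: eq_bigr => f _ /=.
rewrite /multinomial_pmf; case: ifP => _; last by rewrite rmorph0 mul0r.
rewrite rmorphM fmorph_div rmorph_nat rmorph_nat rmorph_prod.
rewrite -!mulrA; congr (_ * _); rewrite natr_prod -prodfV -!big_split /=.
apply: eq_bigr => j _; rewrite rmorphXn mulrA; congr (_ * _); exact: mulrC.
Qed.

Lemma factr_neq0 (R : numDomainType) (k : nat) : k`!%:R != 0 :> R.
Proof. by rewrite pnatr_eq0 -lt0n fact_gt0. Qed.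

(** Each cell count is binomially distributed: put the integrand into the j-th
    factor of the Cauchy product and resum the other factors. *)
Lemma multinomial_marginal (R : realType) (d : nat) (p : 'I_d -> R)
    (p_sum : \sum_(j < d) p j = 1) (n : nat) (j : 'I_d) (g : nat -> R) :
  \sum_(f : {ffun 'I_d -> 'I_n.+1}) multinomial_pmf p n (fun l => f l) * g (f j) =
  \sum_(k < n.+1) 'C(n, k)%:R * p j ^+ k * (1 - p j) ^+ (n - k) * g k.
Proof.
pose G l k : R := if l == j then g k else 1.
have -> : \sum_(f : {ffun 'I_d -> 'I_n.+1}) multinomial_pmf p n (fun l => f l) * g (f j) =
    \sum_(f : {ffun 'I_d -> 'I_n.+1})
       idfun (multinomial_pmf p n (fun j => f j)) * \prod_l G l (f l).
  apply: eq_bigr => f _; rewrite (bigD1 j) //= [G j _]/G eqxx big1 ?mulr1 //.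
  by move=> l /negPf; rewrite /G => ->.
rewrite (multinomial_cauchy idfun) (cauchy_prodE _ (leqnn n)) (bigD1 j) //= coefM.
rewrite mulr_sumr; apply: eq_bigr => -[k /=]; rewrite ltnS => lekn _.
have -> : (\prod_(l | l != j)
      \poly_(i < n.+1) (p l ^+ i / i`!%:R * G l i))`_(n - k) =
    (1 - p j) ^+ (n - k) / (n - k)`!%:R.
  have -> : 1 - p j = \sum_(l | l != j) p l.
    by apply/eqP; rewrite subr_eq -p_sum (bigD1 j) //= addrC.
  rewrite -coef_prod_exp; last exact: factr_neq0.
  rewrite (eq_bigr (fun l => \poly_(i < n.+1) (p l ^+ i / i`!%:R))); last first.
    move=> l /negPf lj.
    by apply: eq_poly => i _; rewrite /G lj mulr1.
  apply: coef_prod_eq => l i lei; rewrite !coef_poly !ltnS lei.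
  by rewrite (leq_trans lei (leq_subr _ _)).
rewrite coef_poly ltnS lekn /G eqxx -(bin_fact lekn) !natrM.
by field; rewrite !factr_neq0.
Qed.

Lemma multinomial_total (R : realType) (d : nat) (p : 'I_d -> R)
    (p_sum : \sum_(j < d) p j = 1) (j : 'I_d) (n : nat) :
  \sum_(f : {ffun 'I_d -> 'I_n.+1}) multinomial_pmf p n (fun j => f j) = 1.
Proof.
transitivity (\sum_(f : {ffun 'I_d -> 'I_n.+1}) multinomial_pmf p n (fun j => f j) * 1).
  by apply: eq_bigr => f _; rewrite mulr1.
rewrite (multinomial_marginal p_sum n j (fun=> 1)).
transitivity ((1 - p j + p j) ^+ n); last by rewrite subrK expr1n.
rewrite exprDn.
by apply: eq_bigr => k _; rewrite mulr1 -[RHS]mulr_natl [X in _ = _ * X]mulrC mulrA.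
Qed.

Lemma multinomial_pmf_ge0 (R : realType) (d : nat) (p : 'I_d -> R)
    (p_ge0 : forall j, 0 <= p j) (n : nat) (i : 'I_d -> nat) :
  0 <= multinomial_pmf p n i.
Proof.
rewrite /multinomial_pmf; case: ifP => // _.
by rewrite mulr_ge0 ?divr_ge0 ?ler0n // prodr_ge0 // => j _; rewrite exprn_ge0.
Qed.

(** * The stopping index *)

Lemma bigminn_le (d k : nat) (s : seq nat) (Q : pred nat) :
  k \in s -> Q k -> (\big[minn/d]_(i <- s | Q i) i <= k)%N.
Proof.
move=> ks Qk; elim: s ks => // i s IH; rewrite in_cons big_cons => /orP[/eqP <-|/IH le].
  by rewrite Qk geq_minl.
by case: ifP => // _; rewrite geq_min le orbT.
Qed.

Lemma sumn_split_last (d : nat) (jd : 'I_d) (hjd : jd.+1 = d)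
    (i : 'I_d -> nat) :
  (\sum_j i j = \sum_(j < d | (j < d.-1)%N) i j + i jd)%N.
Proof.
rewrite (bigD1 jd) //= addnC; congr (_ + _)%N; apply: eq_bigl => j.
by rewrite -val_eqE /=; have := ltn_ord j; lia.
Qed.

(** The defining condition holds at the minimum, and also at the default value
    d, since all cells together hold n packets. *)
Lemma leq_sum_stop_index (d n : nat) (i : 'I_d -> nat) : (\sum_j i j)%N = n ->
  (n.-1 <= \sum_(j < d | j < stop_index n i) i j)%N.
Proof.
move=> sumi; rewrite /stop_index.
elim/big_ind: _ => [|a b ha hb|k ] //; last first.
  by rewrite /minn; case: ifP.
rewrite (eq_bigl xpredT) ?sumi ?leq_pred // => j; exact: ltn_ord.
Qed.

Lemma stop_index_lt (d n : nat) (hd : (2 <= d)%N) (jd : 'I_d)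
    (hjd : jd.+1 = d) (i : 'I_d -> nat) : (\sum_j i j)%N = n ->
  (stop_index n i < d)%N = (i jd <= 1)%N.
Proof.
move=> sumi; have := sumn_split_last hjd i; rewrite sumi => nE.
apply/idP/idP => [Md|ijd].
  have := leq_sum_stop_index sumi; set M := stop_index n i in Md *.
  have : (\sum_(j < d | (j < M)%N) i j <= \sum_(j < d | (j < d.-1)%N) i j)%N.
    rewrite [leqRHS](bigID (fun j : 'I_d => (j < M)%N)) /=.
    rewrite (eq_bigl (fun j : 'I_d => (j < d.-1)%N && (j < M)%N)) ?leq_addr //.
    by move=> j; apply/idP/andP => [jM|[]//]; split => //; lia.
  by lia.
have : (stop_index n i <= d.-1)%N by apply: bigminn_le; [rewrite mem_index_iota; lia | lia].
by lia.
Qed.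

(** The cells from the stopping index on hold together at most one packet, so
    extending the sum to all cells adds only zeros. *)
Lemma collision_sum_all_cells (d n : nat) (hd : (2 <= d)%N) (jd : 'I_d)
    (hjd : jd.+1 = d) (i x : 'I_d -> nat) : (\sum_j i j)%N = n ->
  (forall j, (i j <= 1)%N -> x j = 0%N) ->
  collision_sum n i x = ((i jd <= 1) + \sum_j x j)%N.
Proof.
move=> sumi x0; rewrite /collision_sum (stop_index_lt hd hjd sumi); congr (_ + _)%N.
rewrite [RHS](bigID (fun j : 'I_d => (j < stop_index n i)%N)) /= [X in (_ + X)%N]big1 ?addn0 //.
move=> j jM; apply: x0.
have := leq_sum_stop_index sumi.
have : (\sum_(j0 < d | (j0 < stop_index n i)%N) i j0 + i j <= n)%N.
  rewrite -[leqRHS]sumi [leqRHS](bigID (fun j : 'I_d => (j < stop_index n i)%N)) /= leq_add2l.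
  by rewrite (bigD1 j) //= leq_addr.
by lia.
Qed.

(** * Discrete random variables *)

Section discrete.
Context (R : realType) (d : measure_display) (O : measurableType d)
  (Q : probability O R) (U : countType) (Y : O -> U).
Context (mY : forall u, measurable [set w | Y w = u]).

Lemma measurable_discrete (A : pred U) : measurable [set w | A (Y w)].
Proof.
rewrite [X in measurable X](_ : _ =
  \bigcup_n [set w | if unpickle n is Some u then A u /\ Y w = u else False]).
  apply: bigcup_measurable => n _; case: (unpickle n) => [u|].
    have [Au|/negP nAu] := boolP (A u).
      by rewrite [X in measurable X](_ : _ = [set w | Y w = u]) //; apply/seteqP; split => w /= [].
    by rewrite [X in measurable X](_ : _ = set0) //; apply/seteqP; split => w /= [].
  by rewrite [X in measurable X](_ : _ = set0) //; apply/seteqP; split.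
apply/seteqP; split => w /=.
  by move=> Aw; exists (pickle (Y w)) => //=; rewrite pickleK.
by case=> n _ /=; case: (unpickle n) => // u [Au ->].
Qed.

Lemma prob_discrete_null (A : pred U) :
  (forall u, A u -> Q [set w | Y w = u] = 0)%E -> Q [set w | A (Y w)] = 0%E.
Proof.
move=> Q0; apply: measure_negligible; first exact: measurable_discrete.
apply: (@negligibleS _ _ _ Q (\bigcup_n
    [set w | if unpickle n is Some u then A u /\ Y w = u else False])).
  by move=> w /= Aw; exists (pickle (Y w)) => //=; rewrite pickleK.
apply: negligible_bigcup => n; case: (unpickle n) => [u|].
  have [Au|/negP nAu] := boolP (A u).
    exists [set w | Y w = u]; split; [exact: mY | exact: Q0|by move=> w []].
  by apply: (negligibleS _ (negligible_set0 Q)) => w [].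
by apply: (negligibleS _ (negligible_set0 Q)).
Qed.

Lemma prob_discrete_seq (s : seq U) : uniq s ->
  Q [set w | Y w \in s] = (\sum_(u <- s) Q [set w | Y w = u])%E.
Proof.
elim: s => [_|u s IH /= /andP[us /IH Qs]].
  by rewrite big_nil [X in Q X](_ : _ = set0) ?measure0 //; apply/seteqP; split.
rewrite big_cons -Qs -measureU //.
- congr (Q _); apply/seteqP; split => w /=; rewrite in_cons.
    by case/orP => [/eqP|]; [left|right].
  by case=> [->|->]; rewrite ?eqxx ?orbT.
- exact: (measurable_discrete (fun v => v \in s)).
- by apply/seteqP; split => w //= [-> ]; rewrite (negPf us).
Qed.

(** An event on a countable range reduces to a finite sum as soon as all but
    finitely many of its values are null. *)
Lemma prob_discrete_finite (s : seq U) (A : pred U) : uniq s ->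
  (forall u, u \in s -> A u) ->
  (forall u, A u -> u \notin s -> Q [set w | Y w = u] = 0)%E ->
  Q [set w | A (Y w)] = (\sum_(u <- s) Q [set w | Y w = u])%E.
Proof.
move=> us sA Q0; rewrite -prob_discrete_seq //.
rewrite [X in Q X](_ : _ = [set w | Y w \in s] `|` [set w | A (Y w) && (Y w \notin s)]).
  rewrite measureU0 //.
  - exact: (measurable_discrete (fun v => v \in s)).
  - exact: (measurable_discrete (fun v => A v && (v \notin s))).
  - by apply: (@prob_discrete_null (fun v => A v && (v \notin s))) => u /andP[]; exact: Q0.
apply/seteqP; split => w /=; last by case=> [/sA|/andP[]].
by move=> Aw; case: (boolP (Y w \in s)) => ?; [left|right; rewrite Aw].
Qed.

End discrete.

(** * Absolutely convergent complex series *)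

Lemma normr_complex (R : rcfType) (z : R[i]) : `|z| = (normc z)%:C.
Proof. by []. Qed.

Lemma normc_ge0 (R : rcfType) (z : R[i]) : 0 <= normc z.
Proof. by rewrite -ler0c -normr_complex normr_ge0. Qed.

Lemma normc_real (R : rcfType) (x : R) : normc x%:C = `|x|.
Proof. by rewrite /= expr0n /= addr0 sqrtr_sqr. Qed.

Lemma normcX (R : rcfType) (z : R[i]) (n : nat) : normc (z ^+ n) = normc z ^+ n.
Proof. by apply: complexI; rewrite -normr_complex normrX rmorphXn. Qed.

Lemma normc_prod (R : rcfType) (I : Type) (r : seq I) (Q : pred I)
    (F : I -> R[i]) :
  normc (\prod_(i <- r | Q i) F i) = \prod_(i <- r | Q i) normc (F i).
Proof.
by apply: (big_morph _ (@ComplexField.Normc.normcM R) (ComplexField.Normc.normc1 R)).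
Qed.

Lemma le_normc_sum (R : rcfType) (I : Type) (r : seq I) (Q : pred I)
    (F : I -> R[i]) :
  normc (\sum_(i <- r | Q i) F i) <= \sum_(i <- r | Q i) normc (F i).
Proof. by rewrite -lecR rmorph_sum; exact: (@ler_norm_sum R[i] R[i]). Qed.

Lemma normc_Re (R : rcfType) (z : R[i]) : `|complex.Re z| <= normc z.
Proof. by case: z => a b /=; rewrite -sqrtr_sqr ler_wsqrtr // lerDl sqr_ge0. Qed.

Lemma normc_Im (R : rcfType) (z : R[i]) : `|complex.Im z| <= normc z.
Proof. by case: z => a b /=; rewrite -sqrtr_sqr ler_wsqrtr // lerDr sqr_ge0. Qed.

Lemma normc_le_ReIm (R : rcfType) (a b : R) : normc (a +i* b) <= `|a| + `|b|.
Proof.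
have -> : a +i* b = a%:C + (0 +i* b) by rewrite -[RHS]/((a + 0) +i* (0 + b)) addr0 add0r.
apply: le_trans (le_normcD (_ : Rcomplex R) _) _.
by rewrite /= !expr0n /= addr0 add0r !sqrtr_sqr.
Qed.

Lemma cvgC_squeeze (R : realType) (u : nat -> R[i]^o) (l : R[i]^o)
    (r : nat -> R) :
  (forall n, normc (u n - l : R[i]) <= r n) -> r @ \oo --> (0 : R) ->
  u @ \oo --> l.
Proof.
move=> ur r0; apply/cvgrPdist_le => e e0.
have eE : e = (complex.Re e)%:C by rewrite RRe_real // gtr0_real.
have Re0 : 0 < complex.Re e by rewrite -ltcR -eE.
move/cvgrPdist_le : r0 => /(_ _ Re0); apply: filterS => n.
rewrite sub0r normrN => rn; rewrite distrC eE.
apply: le_trans (_ : (r n)%:C <= _); first by rewrite normr_complex lecR ur.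
by rewrite lecR (le_trans (ler_norm _)).
Qed.

Lemma series_ReE (R : realType) (F : nat -> R[i]) (n : nat) :
  complex.Re (\sum_(0 <= k < n) F k) = \sum_(0 <= k < n) complex.Re (F k).
Proof. by elim/big_rec2: _ => // i x y _ <-; case: (F i) y => ? ? []. Qed.

Lemma series_ImE (R : realType) (F : nat -> R[i]) (n : nat) :
  complex.Im (\sum_(0 <= k < n) F k) = \sum_(0 <= k < n) complex.Im (F k).
Proof. by elim/big_rec2: _ => // i x y _ <-; case: (F i) y => ? ? []. Qed.

Lemma cvgC_ReIm (R : realType) (u : nat -> R[i]^o) (a b : R) :
  (fun n => complex.Re (u n)) @ \oo --> a ->
  (fun n => complex.Im (u n)) @ \oo --> b ->
  u @ \oo --> (a +i* b : R[i]^o).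
Proof.
move=> ua ub; apply: (@cvgC_squeeze _ _ _
  (fun n => `|complex.Re (u n) - a| + `|complex.Im (u n) - b|)).
  by move=> n; case: (u n) => x y; exact: normc_le_ReIm.
rewrite -[X in _ --> X](addr0 (0 : R)); apply: cvgD.
  by apply/norm_cvg0P/subr_cvg0.
by apply/norm_cvg0P/subr_cvg0.
Qed.

(** Absolute convergence implies convergence, through the real and imaginary
    parts. *)
Lemma cvgC_lim_series (R : realType) (F : nat -> R[i]^o) :
  cvgn (series (fun n => normc (F n))) -> exists s : R[i]^o, series F @ \oo --> s.
Proof.
move=> cvF.
have cvRe : cvgn (series (fun n => complex.Re (F n))).
  apply: normed_cvg; apply: series_le_cvg cvF => n /=.
  - exact: normr_ge0.
  - exact: normc_ge0.
  - exact: normc_Re.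
have cvIm : cvgn (series (fun n => complex.Im (F n))).
  apply: normed_cvg; apply: series_le_cvg cvF => n /=.
  - exact: normr_ge0.
  - exact: normc_ge0.
  - exact: normc_Im.
exists (limn (series (fun n => complex.Re (F n)))
        +i* limn (series (fun n => complex.Im (F n)))).
apply: cvgC_ReIm.
  rewrite [X in X @ _ --> _](_ : _ = series (fun n => complex.Re (F n))) //.
  by apply/funext => n; exact: series_ReE.
rewrite [X in X @ _ --> _](_ : _ = series (fun n => complex.Im (F n))) //.
by apply/funext => n; exact: series_ImE.
Qed.

Lemma series_cauchy_prod (K : comNzRingType) (d : nat) (F : 'I_d -> nat -> K)
    (N : nat) :
  \sum_(0 <= n < N.+1) cauchy_prod F n =
  \sum_(f : {ffun 'I_d -> 'I_N.+1} | (\sum_j f j <= N)%N) \prod_j F j (f j).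
Proof.
rewrite big_mkord.
under eq_bigr => n _.
  have leN : (n <= N)%N by rewrite -ltnS.
  rewrite (cauchy_prodE _ leN) coef_prod_poly.
  over.
rewrite (exchange_big_dep (fun f : {ffun 'I_d -> 'I_N.+1} => (\sum_j f j <= N)%N)) /=.
  apply: eq_bigr => f; rewrite -ltnS => fN.
  by rewrite (big_pred1 (Ordinal fN)).
by move=> n f _ /eqP ->; rewrite -ltnS.
Qed.

Lemma prod_series (K : comNzRingType) (d : nat) (F : 'I_d -> nat -> K)
    (N : nat) :
  \prod_j \sum_(0 <= k < N.+1) F j k =
  \sum_(f : {ffun 'I_d -> 'I_N.+1}) \prod_j F j (f j).
Proof. by under eq_bigr do rewrite big_mkord; rewrite bigA_distr_bigA. Qed.

(** The cube of side m lies in the simplex of size N when d * m <= N; with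
    nonnegative terms this compares the product of partial sums with the partial
    sum of the Cauchy product. *)
Lemma prod_series_le_cauchy (R : numDomainType) (d : nat) (a : 'I_d -> nat -> R)
    (N m : nat) : (0 < d)%N -> (forall j k, 0 <= a j k) -> (d * m <= N)%N ->
  \prod_j \sum_(0 <= k < m.+1) a j k <= 
  \sum_(f : {ffun 'I_d -> 'I_N.+1} | (\sum_j f j <= N)%N) \prod_j a j (f j).
Proof.
move=> d_gt0 a_ge0 dm.
have mN : (m.+1 <= N.+1)%N by rewrite ltnS (leq_trans _ dm) // leq_pmull.
under eq_bigr do rewrite big_mkord (big_ord_widen _ _ mN).
rewrite bigA_distr_big [leRHS]big_mkcond [leLHS]big_mkcond /=.
apply: ler_sum => f _; case: ifPn => [/ffun_onP fm|_].
  rewrite ifT //; apply: leq_trans dm.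
  have -> : (d * m = \sum_(j < d) m)%N by rewrite sum_nat_const card_ord.
  apply: leq_sum => j _.
  by have := fm j; rewrite unfold_in ltnS.
by case: ifP => // _; apply: prodr_ge0.
Qed.

(** The product of the partial sums up to N runs over a cube, the partial sum of
    the Cauchy product over a simplex inside it.  The terms outside the simplex
    also lie outside the cube of side N / d, so their absolute sum is at most
    the difference of two values of the same convergent product. *)
Lemma cvg_cauchy_prod (R : realType) (d : nat) (F : 'I_d -> nat -> R[i]^o)
    (s : 'I_d -> R[i]^o) : (0 < d)%N ->
  (forall j, cvgn (series (fun n => normc (F j n)))) ->
  (forall j, series (F j) @ \oo --> s j) ->
  series (cauchy_prod F : nat -> R[i]^o) @ \oo --> (\prod_j s j : R[i]^o).
Proof.
move=> d_gt0 absF Fs.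
pose a j n : R := normc (F j n).
have a_ge0 j n : 0 <= a j n by exact: normc_ge0.
pose A N : R[i]^o := \prod_j series (F j) N.
pose A' N : R := \prod_j series (a j) N.
have cvA : A @ \oo --> (\prod_j s j : R[i]^o).
  by apply: cvg_big => [|j _]; [exact: mul_continuous | exact: Fs].
have cvA' : A' @ \oo --> \prod_j limn (series (a j)).
  by apply: cvg_big => [|j _]; [exact: mul_continuous | exact: absF].
have divoo : (fun N => (N %/ d).+1) @ \oo --> \oo.
  apply/cvgnyPge => m; exists (m * d)%N => // N /= mN.
  by rewrite (leq_trans _ (leqnSn _)) // leq_divRL.
have cvr : (fun N => A' N.+1 - A' (N %/ d).+1) @ \oo --> (0 : R).
  rewrite -[X in _ --> X](subrr (\prod_j limn (series (a j)))); apply: cvgB.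
    by rewrite (cvg_shiftS A').
  exact: cvg_comp divoo cvA'.
pose B : nat -> R[i]^o := series (cauchy_prod F).
have cvBA : (fun N => B N.+1) - (fun N => A N.+1) @ \oo --> (0 : R[i]^o).
  apply: cvgC_squeeze cvr => N; rewrite subr0 -normcN /= fctE opprB.
  rewrite /A /B /series /= prod_series series_cauchy_prod.
  rewrite (bigID (fun f : {ffun 'I_d -> 'I_N.+1} => (\sum_j f j <= N)%N)) /=.
  rewrite addrAC subrr add0r; apply: le_trans (le_normc_sum _ _ _) _.
  under eq_bigr do rewrite normc_prod.
  have -> : A' N.+1 = \sum_(f : {ffun 'I_d -> 'I_N.+1}) \prod_j a j (f j).
    exact: prod_series.
  rewrite [X in _ <= X - _](bigID (fun f : {ffun 'I_d -> 'I_N.+1} => (\sum_j f j <= N)%N)) /=.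
  rewrite [leRHS]addrAC lerDr subr_ge0; apply: prod_series_le_cauchy => //.
  by rewrite mulnC leq_divM.
have cvAS : (fun N => A N.+1) @ \oo --> (\prod_j s j : R[i]^o).
  rewrite (cvg_shiftS A); exact: cvA.
rewrite -/B -(cvg_shiftS B); exact: cvg_sub0 cvBA cvAS.
Qed.

(** * The law of the collision count *)

Definition law (R : realType) (disp : measure_display)
    (T : measurableType disp) (P : probability T R) (c : nat -> {RV P >-> nat})
    (m k : nat) : R :=
  fine (distribution P (c m) [set k]).

Section collisions.
Context (R : realType) (disp : measure_display)
  (T : measurableType disp) (P : probability T R) (c : nat -> {RV P >-> nat}).

Lemma lawE m k : distribution P (c m) [set k] = (law c m k)%:E.
Proof.
by rewrite /law fineK //; exact: fin_num_measure.
Qed.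

Lemma law_ge0 m k : 0 <= law c m k.
Proof. by rewrite -lee_fin -lawE measure_ge0. Qed.

Lemma law_ae0 m : {ae P, forall t, c m t = 0%N} ->
  law c m = fun k => (k == 0%N)%:R.
Proof.
case=> N [mN N0 cN]; apply/funext => k; apply: EFin_inj; rewrite -lawE /=.
have null k' : k' != 0%N -> distribution P (c m) [set k'] = 0%E.
  move=> k0; apply: (@measure_negligible _ _ _ P); first exact: (measurable_funPTI (c m)).
  exists N; split=> //; apply: subset_trans cN => t /= ck c0.
  by move: k0; rewrite -ck c0.
have [->|k0] := eqVneq k 0%N; last exact: null.
transitivity (P (c m @^-1` [set 0%N] `|` c m @^-1` (~` [set 0%N]))); last first.
  by rewrite -preimage_setU setUv preimage_setT probability_setT.
symmetry; apply: measureU0.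
- exact: (measurable_funPTI (c m)).
- exact: (measurable_funPTI (c m)).
apply: measure_negligible; first exact: (measurable_funPTI (c m)).
by exists N; split.
Qed.

(** The distributional identity on point probabilities.  Up to null sets only
    finitely many pairs (split, summands) are compatible with the value k: the
    split has total n, and the summands of cells with at most one packet
    vanish, which bounds all summands by k. *)
Lemma collision_law (d : nat) (hd : (2 <= d)%N) (p : 'I_d -> R)
    (jd : 'I_d) (hjd : jd.+1 = d) (n k : nat) :
  (forall m, (m <= 1)%N -> {ae P, forall t, c m t = 0%N}) ->
  collision_identity p c n ->
  law c n k =
  \sum_(f : {ffun 'I_d -> 'I_n.+1}) multinomial_pmf p n (fun j => f j) *
    \sum_(g : {ffun 'I_d -> 'I_k.+1} | ((f jd <= 1) + \sum_j g j == k)%N)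
       \prod_j law c (f j) (g j).
Proof.
move=> c01 [dO [Om [Q [I [X [QI QIX QC]]]]]].
pose V : Type := ({ffun 'I_d -> nat} * {ffun 'I_d -> nat})%type.
pose Y (w : Om) : V := ([ffun j => I j w], [ffun j => X j w]).
have YE (i x : {ffun 'I_d -> nat}) :
    [set w | Y w = (i, x)] = [set w | forall j, I j w = i j /\ X j w = x j].
  apply/seteqP; split => w /=.
    by case=> /ffunP iE /ffunP xE j; rewrite -iE -xE !ffunE.
  move=> H; congr (_, _); apply/ffunP => j; rewrite ffunE; by case: (H j).
have mY u : measurable [set w | Y w = u].
  case: u => i x; rewrite YE.
  rewrite [X in measurable X](_ : _ =
    \bigcap_(j in setT) (I j @^-1` [set i j] `&` X j @^-1` [set x j])).
    apply: fin_bigcap_measurable; first exact: finite_finset.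
    by move=> j _; apply: measurableI; exact: measurable_funPTI.
  by apply/seteqP; split => w /= H j; [move=> _|]; apply: H.
have QY (i x : {ffun 'I_d -> nat}) : Q [set w | Y w = (i, x)] =
    (multinomial_pmf p n i * \prod_j law c (i j) (x j))%:E.
  rewrite YE QIX QI EFinM; congr (_ * _)%E.
  rewrite -prodEFin; apply: eq_bigr => j _; exact: lawE.
pose A (u : V) : bool := collision_sum n u.1 u.2 == k.
have law0 m x : (m <= 1)%N -> x != 0%N -> law c m x = 0.
  by move=> m1 /negPf x0; rewrite law_ae0 ?x0 //; exact: c01.
pose h (y : {ffun 'I_d -> 'I_n.+1} * {ffun 'I_d -> 'I_k.+1}) : V :=
  ([ffun j => nat_of_ord (y.1 j)], [ffun j => nat_of_ord (y.2 j)]).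
have h_inj : injective h.
  move=> [f g] [f' g'] [/ffunP ff /ffunP gg].
  by congr (_, _); apply/ffunP => j; apply: val_inj;
    [have := ff j | have := gg j]; rewrite !ffunE.
pose s := [seq h y | y <- enum {: {ffun 'I_d -> 'I_n.+1} * {ffun 'I_d -> 'I_k.+1}} & A (h y)].
have QA : Q [set w | A (Y w)] = (\sum_(u <- s) Q [set w | Y w = u])%E.
  apply: prob_discrete_finite => //.
  - by rewrite map_inj_uniq // filter_uniq // enum_uniq.
  - by move=> u /mapP [y]; rewrite mem_filter => /andP[Ay _] ->.
  move=> [i x] /eqP; rewrite /= => cs nin; rewrite QY; congr EFin; apply/eqP.
  rewrite mulf_eq0; apply/orP.
  have [sumi|/negPf sumi] := boolP (\sum_j i j == n)%N; last first.
    by left; rewrite /multinomial_pmf sumi.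
  right; apply/negP => pn0.
  have x0 j : (i j <= 1)%N -> x j = 0%N.
    move=> i1; apply/eqP/negPn/negP => xj0; apply: pn0.
    by rewrite prodf_seq_eq0; apply/hasP; exists j; rewrite ?mem_index_enum //= law0.
  have csE := collision_sum_all_cells hd hjd (eqP sumi) x0.
  have ile j : (i j < n.+1)%N.
    by rewrite ltnS -(eqP sumi) (bigD1 j) //= leq_addr.
  have xle j : (x j < k.+1)%N.
    rewrite ltnS -cs csE (leq_trans _ (leq_addl _ _)) //.
    by rewrite (bigD1 j) //= leq_addr.
  move/negP : nin; apply; apply/mapP.
  exists ([ffun j => Ordinal (ile j)], [ffun j => Ordinal (xle j)]).
    rewrite mem_filter mem_enum andbT /A /h /=.
    rewrite -[X in _ == X]cs; apply/eqP; congr collision_sum; apply/funext => j.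
      by rewrite !ffunE.
    by rewrite !ffunE.
  by rewrite /h; congr (_, _); apply/ffunP => j; rewrite !ffunE.
apply: EFin_inj; rewrite -lawE QC /pushforward.
rewrite [X in Q X](_ : _ = [set w | A (Y w)]); last first.
  have csY w : collision_sum n (Y w).1 (Y w).2 = collision_sum n (I ^~ w) (X ^~ w).
    by congr collision_sum; apply/funext => j; rewrite ffunE.
  by apply/seteqP; split => w; rewrite /A /= csY => /eqP.
rewrite QA /s big_map big_filter big_enum_cond /=.
under [X in X%:E]eq_bigr do rewrite mulr_sumr.
rewrite pair_big_dep /= -sumEFin [LHS]big_mkcond [RHS]big_mkcond /=.
apply: eq_bigr => -[f g] _ /=; rewrite QY.
have -> : multinomial_pmf p n (h (f, g)).1 = multinomial_pmf p n (fun j => f j).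
  by congr multinomial_pmf; apply/funext => j; rewrite ffunE.
have -> : \prod_j law c ([ffun j0 => nat_of_ord (f j0)] j)
      ([ffun j0 => nat_of_ord (g j0)] j) = \prod_j law c (f j) (g j).
  by apply: eq_bigr => j _; rewrite !ffunE.
have [sumi|/negPf sumi] := boolP (\sum_j f j == n)%N; last first.
  by rewrite /multinomial_pmf sumi mul0r; do 2 case: ifP.
have [->|pn0] := eqVneq (\prod_j law c (f j) (g j)) 0.
  by rewrite mulr0; do 2 case: ifP.
rewrite /A /= (_ : collision_sum _ _ _ = ((f jd <= 1) + \sum_j g j)%N) //.
rewrite -(collision_sum_all_cells hd hjd (eqP sumi) (x := fun j => g j)).
  by congr collision_sum; apply/funext => j; rewrite ffunE.
move=> j f1; apply/eqP/negPn/negP => gj0; move/negP: pn0; apply.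
by rewrite prodf_seq_eq0; apply/hasP; exists j; rewrite ?mem_index_enum //= law0.
Qed.

End collisions.

(** * Probability generating functions *)

Lemma cauchy_prod_widen (K : comNzRingType) (d : nat) (F : 'I_d -> nat -> K)
    (N n : nat) : (n <= N)%N ->
  \sum_(f : {ffun 'I_d -> 'I_N.+1} | (\sum_j f j == n)%N) \prod_j F j (f j) =
  cauchy_prod F n.
Proof. by move=> leN; rewrite (cauchy_prodE F leN) coef_prod_poly. Qed.

Definition pgf (R : realType) (disp : measure_display)
    (T : measurableType disp) (P : probability T R) (c : nat -> {RV P >-> nat})
    (m : nat) (z : R[i]) : R[i] :=
  expectationC P (fun t => z ^+ c m t).

Section pgf.
Context (R : realType) (disp : measure_display)
  (T : measurableType disp) (P : probability T R) (c : nat -> {RV P >-> nat}).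

Lemma measurable_fun_of_nat (X : {RV P >-> nat}) (g : nat -> R) :
  measurable_fun [set: T] (EFin \o (fun t => g (X t))).
Proof.
by apply: measurableT_comp => //; apply: (@measurableT_comp _ _ _ _ _ _ g).
Qed.

(** The expectation of an integrable function of c_m is the sum of its values
    weighted by the law, by dominated convergence along the truncations
    c_m < K. *)
Lemma integral_of_nat (m : nat) (g : nat -> R) :
  P.-integrable [set: T] (fun t => (g (c m t))%:E) ->
  series (fun k => law c m k * g k) @ \oo --> \int[P]_t g (c m t).
Proof.
move=> ig.
pose fK K (t : T) : \bar R := (if (c m t < K)%N then g (c m t) else 0)%:E.
have cvK : (\int[P]_t fK K t)%E @[K --> \oo] --> (\int[P]_t (g (c m t))%:E)%E.
  apply: (@dominated_cvg _ _ _ P setT measurableT fK _ (fun t => `|(g (c m t))%:E|%E)) => //.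
  - move=> K; exact: (measurable_fun_of_nat (c m) (fun k => if (k < K)%N then g k else 0)).
  - move=> t _; apply: cvg_near_cst; exists (c m t).+1 => // K /= ltK.
    by rewrite /fK ltK.
  - exact: integrable_abse.
  - move=> K t _; rewrite /fK; case: ifP => // _.
    by rewrite abse0 abse_ge0.
have intK K : (\int[P]_t fK K t)%E = (series (fun k => law c m k * g k) K)%:E.
  rewrite /series /= -sumEFin big_mkord.
  transitivity (\int[P]_t \sum_(k < K) ((g k)%:E * (\1_(c m @^-1` [set (k : nat)]) t)%:E))%E.
    apply: eq_integral => t _; rewrite /fK; case: ifPn => [ltK|geK].
      rewrite (bigD1 (Ordinal ltK)) //= indicE mem_set //= mule1 big1 ?adde0 //.
      move=> k kt; rewrite indicE memNset ?mule0 //= => ck.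
      by move/negP : kt; apply; apply/eqP/val_inj.
    rewrite big1 // => k _; rewrite indicE memNset ?mule0 //= => ck.
    by move/negP : geK; apply; rewrite ck.
  rewrite integral_sum //.
    apply: eq_bigr => k _; rewrite integralZl //; last first.
      apply: integrable_indic => //; first exact: (measurable_funPTI (c m)).
    rewrite integral_indic //; last exact: (measurable_funPTI (c m)).
    by rewrite setIT muleC EFinM -lawE.
  move=> k; apply: integrableZl => //; apply: integrable_indic => //.
  exact: (measurable_funPTI (c m)).
have fin : (\int[P]_t (g (c m t))%:E)%E \is a fin_num by exact: integrable_fin_num.
have -> : series (fun k => law c m k * g k) = fine \o (fun K => \int[P]_t fK K t)%E.
  by apply/funext => K; rewrite /= intK.
by apply: fine_cvg; rewrite fineK.
Qed.

Lemma integrable_le_normc (m : nat) (z : R[i]) (g : nat -> R) :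
  P.-integrable [set: T] (fun t => (normc (z ^+ c m t))%:E) ->
  (forall k, `|g k| <= normc (z ^+ k)) ->
  P.-integrable [set: T] (fun t => (g (c m t))%:E).
Proof.
move=> iz gz; apply: (le_integrable measurableT _ _ iz).
  exact: measurable_fun_of_nat.
move=> t _; rewrite /= lee_fin (le_trans (gz _)) //; exact: ler_norm.
Qed.

Lemma cvg_pgf (m : nat) (z : R[i]) :
  P.-integrable [set: T] (fun t => (normc (z ^+ c m t))%:E) ->
  series (fun k => (law c m k)%:C * z ^+ k : R[i]^o) @ \oo --> (pgf c m z : R[i]^o).
Proof.
move=> iz.
have ReE (a : R) (w : R[i]) : complex.Re (a%:C * w) = a * complex.Re w.
  by case: w => x y /=; rewrite mul0r subr0.
have ImE (a : R) (w : R[i]) : complex.Im (a%:C * w) = a * complex.Im w.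
  by case: w => x y /=; rewrite mul0r addr0.
apply: cvgC_ReIm.
  rewrite [X in X @ _ --> _](_ : _ =
      series (fun k => law c m k * complex.Re (z ^+ k))); last first.
    apply/funext => K; rewrite /series /= series_ReE.
    by apply: eq_bigr => k _; rewrite ReE.
  exact: integral_of_nat (integrable_le_normc iz (fun k => normc_Re (z ^+ k))).
rewrite [X in X @ _ --> _](_ : _ =
    series (fun k => law c m k * complex.Im (z ^+ k))); last first.
  apply/funext => K; rewrite /series /= series_ImE.
  by apply: eq_bigr => k _; rewrite ImE.
exact: integral_of_nat (integrable_le_normc iz (fun k => normc_Im (z ^+ k))).
Qed.

Lemma cvg_abs_pgf (m : nat) (z : R[i]) :
  P.-integrable [set: T] (fun t => (normc (z ^+ c m t))%:E) ->
  cvgn (series (fun k => normc ((law c m k)%:C * z ^+ k))).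
Proof.
move=> iz; apply/cvg_ex; exists (\int[P]_t normc (z ^+ c m t)).
rewrite [X in series X](_ : _ = (fun k => law c m k * normc (z ^+ k))).
  exact: (@integral_of_nat m (fun k => normc (z ^+ k))).
apply/funext => k.
by rewrite ComplexField.Normc.normcM normc_real ger0_norm ?law_ge0.
Qed.

Lemma pgf_ae0 (m : nat) (z : R[i]) : {ae P, forall t, c m t = 0%N} ->
  pgf c m z = 1.
Proof.
move=> c0; rewrite /pgf /expectationC.
have E (h : R[i] -> R) : \int[P]_t h (z ^+ c m t) = h 1.
  rewrite /Rintegral (@ae_eq_integral _ _ _ P setT (cst (h 1)%:E)) //.
  - have PT : P setT = 1%E by exact: probability_setT.
    by rewrite integral_cst // [X in (_ * X)%E]PT mule1.
  - exact: (measurable_fun_of_nat (c m) (fun k => h (z ^+ k))).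
  - by apply: filterS c0 => t -> _; rewrite expr0.
by rewrite !E.
Qed.

(** Both sides are sums of the same series in powers of z: the law of c_n is a
    combination of convolutions of the laws of the c_(i_j), shifted by one when
    the last cell holds at most one packet, and products of generating functions
    are Cauchy products. *)
Lemma pgf_recursion (d : nat) (hd : (2 <= d)%N) (p : 'I_d -> R)
    (jd : 'I_d) (hjd : jd.+1 = d) (n : nat) (z : R[i]) :
  (forall m, (m <= 1)%N -> {ae P, forall t, c m t = 0%N}) ->
  collision_identity p c n ->
  (forall m, P.-integrable [set: T] (fun t => (normc (z ^+ c m t))%:E)) ->
  pgf c n z =
  \sum_(f : {ffun 'I_d -> 'I_n.+1}) (multinomial_pmf p n (fun j => f j))%:C *
    (z ^+ (f jd <= 1)%N * \prod_j pgf c (f j) z).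
Proof.
move=> c01 cid iz.
pose F m k : R[i]^o := (law c m k)%:C * z ^+ k.
have d_gt0 : (0 < d)%N by exact: ltnW.
pose inner (f : {ffun 'I_d -> 'I_n.+1}) (k : nat) : R[i]^o :=
  \sum_(g : {ffun 'I_d -> 'I_k.+1} | ((f jd <= 1) + \sum_j g j == k)%N)
     \prod_j (law c (f j) (g j))%:C * z ^+ k.
have FE k : F n k = \sum_(f : {ffun 'I_d -> 'I_n.+1})
    (multinomial_pmf p n (fun j => f j))%:C * inner f k.
  rewrite /F (collision_law hd hjd _ c01 cid) rmorph_sum mulr_suml.
  apply: eq_bigr => f _; rewrite rmorphM -mulrA; congr (_ * _).
  rewrite rmorph_sum mulr_suml; apply: eq_bigr => g _.
  by rewrite rmorph_prod.
have cvinner f : series (inner f) @ \oo -->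
    (z ^+ (f jd <= 1)%N * \prod_j pgf c (f j) z : R[i]^o).
  have cvC : series (cauchy_prod (fun j => F (f j)) : nat -> R[i]^o) @ \oo -->
      (\prod_j pgf c (f j) z : R[i]^o).
    apply: cvg_cauchy_prod => // j; first exact: cvg_abs_pgf.
    exact: cvg_pgf.
  have prodF k (g : {ffun 'I_d -> 'I_k.+1}) : \prod_j F (f j) (g j) =
      (\prod_j (law c (f j) (g j))%:C) * z ^+ (\sum_j g j).
    rewrite /F big_split /=; congr (_ * _).
    by rewrite prodrXr.
  have innerE k : inner f k = if ((f jd <= 1)%N <= k)%N then
      z ^+ (f jd <= 1)%N * cauchy_prod (fun j => F (f j)) (k - (f jd <= 1)%N) else 0.
    rewrite /inner; set e : nat := (f jd <= 1)%N; case: leqP => ek.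
      rewrite -(@cauchy_prod_widen _ _ _ k) ?leq_subr // mulr_sumr.
      apply: eq_big => [g|g /eqP eg]; first by rewrite -[RHS](eqn_add2l e) subnKC.
      by rewrite prodF -[X in z ^+ X]eg exprD mulrCA.
    by rewrite big1 // => g /eqP eg; lia.
  case: (f jd <= 1)%N innerE => /= innerE.
    rewrite -(cvg_shiftS (series (inner f))).
    rewrite [X in X @ _ --> _](_ : _ = fun K => z *
        series (cauchy_prod (fun j => F (f j)) : nat -> R[i]^o) K); last first.
      apply/funext => K; rewrite /series /= big_nat_recl // innerE ltnn add0r mulr_sumr.
      by apply: eq_bigr => k _; rewrite innerE subn1.
    by rewrite expr1; apply: cvgM; [exact: cvg_cst | exact: cvC].
  rewrite expr0 mul1r [X in series X](_ : _ = cauchy_prod (fun j => F (f j))) //.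
  by apply/funext => k; rewrite innerE expr0 mul1r subn0.
have cvF : series (F n) @ \oo --> (pgf c n z : R[i]^o) by exact: cvg_pgf.
suff cvS : series (F n) @ \oo --> (\sum_(f : {ffun 'I_d -> 'I_n.+1})
    (multinomial_pmf p n (fun j => f j))%:C *
    (z ^+ (f jd <= 1)%N * \prod_j pgf c (f j) z) : R[i]^o).
  by apply: (cvg_unique _ cvF cvS); exact: norm_hausdorff.
rewrite [X in X @ _ --> _](_ : _ = fun K => \sum_(f : {ffun 'I_d -> 'I_n.+1})
    (multinomial_pmf p n (fun j => f j))%:C * series (inner f) K); last first.
  apply/funext => K; rewrite /series /=.
  under eq_bigr do rewrite FE.
  by rewrite exchange_big /=; apply: eq_bigr => f _; rewrite mulr_sumr.
apply: cvg_big => [|f _]; first exact: add_continuous.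
by apply: cvgM; [exact: cvg_cst | exact: cvinner].
Qed.

End pgf.

(** * The functional equation *)

(** The coefficient of x^n / n! in a product of exponential generating
    functions at the points p_j x is a multinomial expectation. *)
Lemma egf_cauchy_prod (R : realType) (d : nat) (p : 'I_d -> R) (x : R[i])
    (h : 'I_d -> nat -> R[i]) (n : nat) :
  cauchy_prod (fun j k => ((p j)%:C * x) ^+ k / k`!%:R * h j k) n =
  x ^+ n / n`!%:R *
  \sum_(f : {ffun 'I_d -> 'I_n.+1})
     (multinomial_pmf p n (fun j => f j))%:C * \prod_j h j (f j).
Proof.
transitivity (n`!%:R^-1 * \sum_(f : {ffun 'I_d -> 'I_n.+1})
    (multinomial_pmf p n (fun j => f j))%:C * \prod_j (x ^+ f j * h j (f j))).
  rewrite (multinomial_cauchy (real_complex R) p n (fun j k => x ^+ k * h j k)).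
  rewrite mulrA mulVf ?factr_neq0 // mul1r.
  apply: eq_bigr => f _; apply: eq_bigr => j _.
  by rewrite exprMn mulrA; congr (_ * _); rewrite mulrAC.
rewrite -mulrA mulrCA; congr (_ * _); rewrite mulr_sumr; apply: eq_bigr => f _.
rewrite big_split /= prodrXr [RHS]mulrCA /multinomial_pmf.
by case: eqP => [->//|_]; rewrite !mul0r.
Qed.

Lemma cvg_series_supp01 (K : numFieldType) (u : nat -> K) :
  (forall k, (2 <= k)%N -> u k = 0) -> series u @ \oo --> (u 0%N + u 1%N : K^o).
Proof.
move=> u0; apply: cvg_near_cst; exists 2%N => // n /= n2.
rewrite /series /= -(subnKC n2) big_nat_recl // big_nat_recl // addrA.
by rewrite big1 ?addr0 // => k _; rewrite u0.
Qed.

Section Rtilde.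
Context (R : realType) (disp : measure_display)
  (T : measurableType disp) (P : probability T R) (c : nat -> {RV P >-> nat}).

Lemma normc_le1X (z : R[i]) (k : nat) : `|z| <= 1 -> normc (z ^+ k) <= 1.
Proof.
move=> z1; rewrite normcX exprn_ile1 ?normc_ge0 //.
by rewrite -lecR -normr_complex rmorph1.
Qed.

Lemma integrable_bounded (m : nat) (g : nat -> R) (M : R) :
  (forall k, `|g k| <= M) -> P.-integrable [set: T] (fun t => (g (c m t))%:E).
Proof.
move=> gM; apply: (@le_integrable _ _ _ P setT measurableT _ (cst M%:E)).
- exact: measurable_fun_of_nat.
- by move=> t _; rewrite /= lee_fin (le_trans (gM _)) // ler_norm.
- exact: finite_measure_integrable_cst.
Qed.

Lemma Rintegral_bounded (m : nat) (g : nat -> R) (M : R) :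
  (forall k, `|g k| <= M) -> `|\int[P]_t g (c m t)| <= M.
Proof.
move=> gM; have ig := integrable_bounded m gM.
apply: le_trans (le_normr_Rintegral measurableT ig) _.
have <- : \int[P]_t M = M.
  have PT : P setT = 1%E by exact: probability_setT.
  by rewrite /Rintegral integral_cst // [X in (_ * X)%E]PT mule1.
apply: le_Rintegral => //.
- by apply: (@integrable_bounded m (fun k => `|g k|) M) => k; rewrite normr_id.
- exact: finite_measure_integrable_cst.
Qed.

(** On the unit disk the expectations have modulus at most 2, by bounding real
    and imaginary parts separately, so twice the exponential series dominates. *)
Lemma Rtilde_abs_cvg_disk (x z : R[i]) : `|z| <= 1 -> Rtilde_abs_cvg c x z.
Proof.
move=> z1; split.
  move=> n; apply: (@integrable_bounded n (fun k => normc (z ^+ k)) 1) => k.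
  by rewrite ger0_norm ?normc_ge0 ?normc_le1X.
apply: (@series_le_cvg _ _ (fun n => 2 * exp_coeff (normc x) n)).
- by move=> n; exact: normc_ge0.
- by move=> n; rewrite mulr_ge0 ?exp_coeff_ge0 ?normc_ge0.
- move=> n; rewrite /Rtilde_term !ComplexField.Normc.normcM ComplexField.Normc.normcV.
  rewrite normcX mulrC /exp_coeff.
  have -> : normc (n`!%:R : R[i]) = n`!%:R.
    by rewrite -(rmorph_nat (real_complex R)) normc_real ger0_norm.
  apply: ler_wpM2r; first by rewrite divr_ge0 ?exprn_ge0 ?normc_ge0.
  apply: le_trans (normc_le_ReIm _ _) _; rewrite -[2]/(1 + 1); apply: lerD.
    apply: (@Rintegral_bounded n (fun k => complex.Re (z ^+ k)) 1) => k.
    by rewrite (le_trans (normc_Re _)) ?normc_le1X.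
  apply: (@Rintegral_bounded n (fun k => complex.Im (z ^+ k)) 1) => k.
  by rewrite (le_trans (normc_Im _)) ?normc_le1X.
- rewrite [X in cvgn X](_ : _ = fun N => 2 * series (exp_coeff (normc x)) N).
    by apply: is_cvgM; [exact: is_cvg_cst | exact: is_cvg_series_exp_coeff].
  by apply/funext => N; rewrite /series /= mulr_sumr.
Qed.

Lemma Rtilde_abs_cvg_scale (x z : R[i]) (a : R) : 0 <= a <= 1 ->
  Rtilde_abs_cvg c x z -> Rtilde_abs_cvg c (a%:C * x) z.
Proof.
move=> /andP[a0 a1] [iz cvx]; split; first exact: iz.
apply: (@series_le_cvg R (fun n => normc (Rtilde_term c (a%:C * x) z n))
  (fun n => normc (Rtilde_term c x z n))) => [n|n|n|].
- exact: (normc_ge0 (Rtilde_term c (a%:C * x) z n)).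
- exact: (normc_ge0 (Rtilde_term c x z n)).
- have -> : Rtilde_term c (a%:C * x) z n = a%:C ^+ n * Rtilde_term c x z n :> R[i].
    by rewrite /Rtilde_term exprMn -!mulrA.
  rewrite ComplexField.Normc.normcM normcX normc_real ger0_norm //.
  by rewrite ler_piMl ?normc_ge0 // exprn_ile1.
- exact: cvx.
Qed.

Lemma cvg_Rtilde (x z : R[i]) : Rtilde_abs_cvg c x z ->
  series (Rtilde_term c x z) @ \oo --> (Rtilde c x z : R[i]^o).
Proof. by case=> _ /cvgC_lim_series [s /cvgP]. Qed.

(** A collects the full products, B those whose factor for the last cell is cut
    down to 1 + p_d x, and E the corrections at n = 0 and n = 1, where the
    recursion does not apply. *)
Lemma Rtilde_functional (d : nat) (hd : (2 <= d)%N) (p : 'I_d -> R)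
    (p_ge0 : forall j, 0 <= p j) (p_sum : \sum_(j < d) p j = 1)
    (jd : 'I_d) (hjd : jd.+1 = d) (hc : sicta_collisions p c) (x z : R[i]) :
  Rtilde_abs_cvg c x z ->
  Rtilde c x z =
  (1 + x) * (1 - z)
  + (z - 1) * (x * (p jd)%:C + 1)
    * \prod_(i < d | i != jd) Rtilde c ((p i)%:C * x) z
  + \prod_(j < d) Rtilde c ((p j)%:C * x) z.
Proof.
move=> absx; have [c0 c1 cn] := hc.
have c01 m : (m <= 1)%N -> {ae P, forall t, c m t = 0%N} by case: m => [|[|]].
have pgf1 m : (m <= 1)%N -> pgf c m z = 1 by move=> /c01 /pgf_ae0.
have d_gt0 : (0 < d)%N by exact: ltnW.
have p01 j : 0 <= p j <= 1.
  by rewrite p_ge0 -p_sum (bigD1 j) //= lerDl sumr_ge0.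
have absp j := Rtilde_abs_cvg_scale (p01 j) absx.
pose A := cauchy_prod (fun j => Rtilde_term c ((p j)%:C * x) z).
have AE n : A n = x ^+ n / n`!%:R * \sum_(f : {ffun 'I_d -> 'I_n.+1})
     (multinomial_pmf p n (fun j => f j))%:C * \prod_j pgf c (f j) z.
  exact: (egf_cauchy_prod p x (fun _ k => pgf c k z)).
have cvA : series (A : nat -> R[i]^o) @ \oo -->
    (\prod_j Rtilde c ((p j)%:C * x) z : R[i]^o).
  apply: cvg_cauchy_prod => // j; first by case: (absp j).
  exact: (cvg_Rtilde (absp j)).
(* h equals the generating function at arguments at most 1, where both are 1,
   so cutting the factor of the last cell costs only the indicator. *)
pose h (j : 'I_d) k : R[i] := if j == jd then (k <= 1)%N%:R else pgf c k z.
pose G (j : 'I_d) k : R[i]^o := ((p j)%:C * x) ^+ k / k`!%:R * h j k.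
have GE j : j != jd -> G j = Rtilde_term c ((p j)%:C * x) z.
  by move=> /negPf jj; apply/funext => k; rewrite /G /h jj.
have Gd k : (2 <= k)%N -> G jd k = 0.
  by case: k => [|[|k]] // _; rewrite /G /h eqxx mulr0.
pose s j : R[i]^o := if j == jd then 1 + (p jd)%:C * x else Rtilde c ((p j)%:C * x) z.
have cvG j : series (G j) @ \oo --> s j.
  rewrite /s; have [->|jj] := eqVneq j jd; last first.
    by rewrite (GE _ jj); exact: (cvg_Rtilde (absp j)).
  have h1 k : (k <= 1)%N -> h jd k = 1 by move=> k1; rewrite /h eqxx k1.
  have <- : G jd 0%N = 1 by rewrite /G h1 // mulr1 expr0 (_ : 0`! = 1%N) // divr1.
  have <- : G jd 1%N = (p jd)%:C * x by rewrite /G h1 // mulr1 expr1 (_ : 1`! = 1%N) // divr1.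
  exact: (cvg_series_supp01 Gd).
have absG j : cvgn (series (fun k => normc (G j k))).
  have [->|jj] := eqVneq j jd; last by rewrite (GE _ jj); case: (absp j).
  apply/cvg_ex; eexists; apply: cvg_series_supp01 => k k2.
  by rewrite Gd // ComplexField.Normc.normc0.
pose B := cauchy_prod G.
have BE n : B n = x ^+ n / n`!%:R * \sum_(f : {ffun 'I_d -> 'I_n.+1})
     (multinomial_pmf p n (fun j => f j))%:C *
     ((f jd <= 1)%N%:R * \prod_j pgf c (f j) z).
  rewrite /B egf_cauchy_prod; congr (_ * _); apply: eq_bigr => f _; congr (_ * _).
  rewrite [LHS](bigD1 jd) //= [X in _ = _ * X](bigD1 jd) //= /h eqxx.
  rewrite [RHS]mulrA; congr (_ * _); last first.
    by apply: eq_bigr => j /negPf ->.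
  by case: (leqP (f jd) 1) => [/pgf1 ->|_]; rewrite ?mulr1 ?mul0r.
have cvB : series (B : nat -> R[i]^o) @ \oo --> (\prod_j s j : R[i]^o).
  exact: cvg_cauchy_prod.
pose E (n : nat) : R[i] := if n is n'.+1 then (if n' == 0%N then x * (1 - z) else 0) else 1 - z.
have cvE : series (E : nat -> R[i]^o) @ \oo --> ((1 - z) + x * (1 - z) : R[i]^o).
  by apply: (@cvg_series_supp01 _ E) => -[|[|k]].
have small n : (n <= 1)%N -> A n = x ^+ n / n`!%:R /\ B n = x ^+ n / n`!%:R.
  move=> n1.
  have fn (f : {ffun 'I_d -> 'I_n.+1}) j : (f j <= 1)%N.
    by rewrite (leq_trans _ n1) // -ltnS.
  have total : \sum_(f : {ffun 'I_d -> 'I_n.+1})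
      (multinomial_pmf p n (fun j => f j))%:C = 1 :> R[i].
    by rewrite -rmorph_sum /= (multinomial_total p_sum jd).
  have prod1 (f : {ffun 'I_d -> 'I_n.+1}) : \prod_j pgf c (f j) z = 1.
    by apply: big1 => j _; exact: pgf1.
  rewrite AE BE -[X in _ = X /\ _]mulr1 -[X in _ /\ _ = X]mulr1.
  rewrite -[X in _ = _ * X /\ _]total -[X in _ /\ _ = _ * X]total.
  by split; congr (_ * _); apply: eq_bigr => f _; rewrite prod1 ?fn !mulr1.
have TE n : Rtilde_term c x z n = A n + (z - 1) * B n + E n.
  have [n1|n2] := leqP n 1.
    have [-> ->] := small n n1.
    rewrite /Rtilde_term -/(pgf c n z) pgf1 //.
    by case: n n1 => [|[|]] //= _; rewrite ?expr0 ?expr1 !divr1; ring.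
  have -> : E n = 0 by case: n n2 => [|[|]].
  rewrite addr0 AE BE mulrCA -mulrDr /Rtilde_term -/(pgf c n z); congr (_ * _).
  rewrite (pgf_recursion hd hjd c01 (cn _ n2)); last by case: absx.
  rewrite mulr_sumr -big_split /=; apply: eq_bigr => f _.
  by case: (leqP (f jd) 1) => _ /=; rewrite ?expr0 ?expr1; ring.
have cvT : series (Rtilde_term c x z) @ \oo -->
    (\prod_j Rtilde c ((p j)%:C * x) z + (z - 1) * \prod_j s j +
      ((1 - z) + x * (1 - z)) : R[i]^o).
  rewrite [X in X @ _ --> _](_ : _ = fun N => series (A : nat -> R[i]^o) N +
    (z - 1) * series (B : nat -> R[i]^o) N + series (E : nat -> R[i]^o) N); last first.
    apply/funext => N; rewrite /series /= mulr_sumr -!big_split /=.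
    by apply: eq_bigr => k _; exact: TE.
  have cvB' : (fun N => (z - 1) * series (B : nat -> R[i]^o) N) @ \oo -->
      ((z - 1) * \prod_j s j : R[i]^o).
    by apply: cvgM; [exact: cvg_cst | exact: cvB].
  exact: (cvgD (cvgD cvA cvB') cvE).
have -> : Rtilde c x z = \prod_j Rtilde c ((p j)%:C * x) z + (z - 1) * \prod_j s j +
      ((1 - z) + x * (1 - z)).
  by apply: (cvg_unique _ (cvg_Rtilde absx) cvT); exact: norm_hausdorff.
have -> : \prod_j s j =
    (1 + (p jd)%:C * x) * \prod_(i < d | i != jd) Rtilde c ((p i)%:C * x) z.
  rewrite (bigD1 jd) //= {1}/s eqxx; congr (_ * _).
  by apply: eq_bigr => j /negPf jj; rewrite /s jj.
set U := \prod_j _; set W := \prod_(_ | _) _.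
rewrite [RHS]addrC [X in _ + X]addrC; ring.
Qed.

End Rtilde.

(** * The linear recursion for the means *)

Lemma bin_mul_bin (n k i : nat) : (i + k <= n)%N ->
  ('C(n, i + k) * 'C(i + k, i) = 'C(n, i) * 'C(n - i, k))%N.
Proof.
move=> le.
have H1 := bin_fact le.
have H2 := bin_fact (leq_addr k i); rewrite addKn in H2.
have H3 : ('C(n, i) * (i`! * (n - i)`!) = n`!)%N by apply: bin_fact; lia.
have H4 : ('C(n - i, k) * (k`! * (n - i - k)`!) = (n - i)`!)%N by apply: bin_fact; lia.
rewrite -subnDA in H4.
have pos : (0 < i`! * k`! * (n - (i + k))`!)%N by rewrite !muln_gt0 !fact_gt0.
apply/eqP; rewrite -(eqn_pmul2r pos); apply/eqP; transitivity n`!.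
  by rewrite -H1 -H2; ring.
by rewrite -H3 -H4; ring.
Qed.

(** The factorial moments of the binomial distribution, in binomial form. *)
Lemma binomial_moment (R : comNzRingType) (n i : nat) (a : R) :
  \sum_(k < n.+1) 'C(n, k)%:R * a ^+ k * (1 - a) ^+ (n - k) * 'C(k, i)%:R =
  'C(n, i)%:R * a ^+ i.
Proof.
rewrite -(big_mkord xpredT (fun k => 'C(n, k)%:R * a ^+ k * (1 - a) ^+ (n - k) * 'C(k, i)%:R)).
have [lein|ltni] := leqP i n; last first.
  rewrite (bin_small ltni) mul0r big_nat big1 // => k kn.
  by rewrite (@bin_small k) ?mulr0 //; lia.
rewrite (big_cat_nat (n := i)) //=; last by rewrite (leq_trans lein).
rewrite big_nat big1 ?add0r; last by move=> k ki; rewrite (@bin_small k) ?mulr0 //; lia.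
rewrite -{1}(add0n i) big_addn subSn // big_mkord.
transitivity ('C(n, i)%:R * a ^+ i * (1 - a + a) ^+ (n - i)); last first.
  by rewrite subrK expr1n mulr1.
rewrite exprDn mulr_sumr; apply: eq_bigr => k _.
have ikn : (i + k <= n)%N by have := ltn_ord k; lia.
have /(congr1 (fun m => m%:R : R)) := bin_mul_bin ikn; rewrite !natrM (addnC i k) => H.
rewrite -[X in _ * X]mulr_natl exprD subnDA subnAC.
transitivity ('C(n, (k + i))%:R * 'C(k + i, i)%:R * (a ^+ k * a ^+ i * (1 - a) ^+ (n - i - k))).
  ring.
rewrite H; ring.
Qed.

(** For m > 0 the right-hand side vanishes at y = 1, while its value at
    y = p_d is minus the probability that a binomial(m + 1, p_d) variable is at
    most 1; this is how the inhomogeneous term of the recursion arises. *)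
Lemma alternating_bin_sum (R : comNzRingType) (m : nat) (y : R) :
  \sum_(i < m.+2) 'C(m.+1, i)%:R * ((-1) ^+ i * (i%:R - 1) * y ^+ i) =
  - (1 - y) ^+ m.+1 - m.+1%:R * y * (1 - y) ^+ m.
Proof.
rewrite (eq_bigr (fun i : 'I_m.+2 =>
  'C(m.+1, i)%:R * i%:R * (- y) ^+ i - (1 ^+ (m.+1 - i) * (- y) ^+ i) *+ 'C(m.+1, i))); last first.
  move=> i _; rewrite expr1n mul1r -[X in _ = _ - X]mulr_natl [(- y) ^+ i]exprNn.
  move: (_ ^+ i) (y ^+ i) ((i : nat)%:R : R) ('C(m.+1, i)%:R : R) => s Y I B.
  by ring.
rewrite big_split /= sumrN -exprDn addrC; congr (_ + _).
rewrite big_ord_recl /= mulr0 mul0r add0r.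
rewrite exprDn mulr_sumr -sumrN; apply: eq_bigr => i _.
rewrite -natrM mulnC -mul_bin_diag natrM expr1n mul1r.
rewrite -[X in _ = - (_ * X)]mulr_natl exprS /=.
move: ((- y) ^+ i) (m.+1%:R : R) ('C(m, i)%:R : R) => Y M B.
by ring.
Qed.

Section linear_recursion.
Context (R : realType) (d : nat) (p : 'I_d -> R).
Context (p_ge0 : forall j, 0 <= p j) (p_sum : \sum_(j < d) p j = 1)
  (p_neq1 : forall j, p j <> 1) (jd : 'I_d).

Lemma cell_prob_lt1 j : p j < 1.
Proof.
rewrite lt_neqAle; apply/andP; split; first exact/eqP.
by rewrite -p_sum (bigD1 j) //= lerDl sumr_ge0.
Qed.

Lemma sum_pow_lt1 n : (2 <= n)%N -> \sum_j p j ^+ n < 1.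
Proof.
case: n => [//|[//|n]] _.
have le j : 0 <= p j - p j ^+ n.+2.
  by rewrite subr_ge0 exprS ler_piMr // exprn_ile1 // ltW // cell_prob_lt1.
have : 0 <= \sum_j (p j - p j ^+ n.+2) by apply: sumr_ge0.
rewrite sumrB p_sum subr_ge0 le_eqVlt => /orP[/eqP E|//].
have /psumr_eq0P H : \sum_j (p j - p j ^+ n.+2) = 0 by rewrite sumrB p_sum E subrr.
have p0 j : p j = 0.
  have /eqP := H (fun i _ => le i) j isT.
  rewrite exprS -{1}(mulr1 (p j)) -mulrBr mulf_eq0 => /orP[/eqP//|].
  rewrite subr_eq0 => /eqP E1.
  have : p j ^+ n.+1 < 1 by rewrite exprn_ilt1 // cell_prob_lt1.
  by rewrite -E1 ltxx.
by have := oner_neq0 R; rewrite -p_sum big1 ?eqxx.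
Qed.

Definition collision_rec (n : nat) (v : nat -> R) : R :=
  \sum_(f : {ffun 'I_d -> 'I_n.+1}) multinomial_pmf p n (fun j => f j) *
    ((f jd <= 1)%N%:R + \sum_j v (f j)).

Lemma collision_recE (n : nat) (v : nat -> R) :
  collision_rec n v =
  \sum_(k < n.+1) 'C(n, k)%:R * p jd ^+ k * (1 - p jd) ^+ (n - k) * (k <= 1)%N%:R
  + \sum_j \sum_(k < n.+1) 'C(n, k)%:R * p j ^+ k * (1 - p j) ^+ (n - k) * v k.
Proof.
rewrite -(multinomial_marginal p_sum n jd (fun k => (k <= 1)%N%:R)).
under [X in _ = _ + X]eq_bigr do rewrite -(multinomial_marginal p_sum).
rewrite exchange_big /= -big_split /=; apply: eq_bigr => f _.
by rewrite mulrDr mulr_sumr.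
Qed.

(** The unknown v n occurs on the right with the coefficient p_1^n + ... + p_d^n:
    this is the event that all packets fall into one cell. *)
Lemma collision_rec_recr (n : nat) (v : nat -> R) :
  collision_rec n v = 
  \sum_(k < n.+1) 'C(n, k)%:R * p jd ^+ k * (1 - p jd) ^+ (n - k) * (k <= 1)%N%:R
  + \sum_j \sum_(k < n) 'C(n, k)%:R * p j ^+ k * (1 - p j) ^+ (n - k) * v k
  + (\sum_j p j ^+ n) * v n.
Proof.
rewrite collision_recE -addrA; congr (_ + _).
rewrite mulr_suml -big_split /=; apply: eq_bigr => j _.
by rewrite big_ord_recr /= binn mul1r subnn expr0 mulr1.
Qed.

Lemma collision_rec_unique (v w : nat -> R) :
  (forall n, (n <= 1)%N -> v n = w n) ->
  (forall n, (2 <= n)%N -> v n = collision_rec n v) ->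
  (forall n, (2 <= n)%N -> w n = collision_rec n w) -> v =1 w.
Proof.
move=> vw01 vE wE; elim/ltn_ind => n IH.
have [n1|n2] := leqP n 1; first exact: vw01.
have s1 : 1 - \sum_j p j ^+ n != 0 by rewrite subr_eq0 eq_sym lt_eqF ?sum_pow_lt1.
apply: (mulfI s1).
have := vE n n2; have := wE n n2; rewrite !collision_rec_recr.
have -> : \sum_j \sum_(k < n) 'C(n, k)%:R * p j ^+ k * (1 - p j) ^+ (n - k) * v k =
  \sum_j \sum_(k < n) 'C(n, k)%:R * p j ^+ k * (1 - p j) ^+ (n - k) * w k.
  by apply: eq_bigr => j _; apply: eq_bigr => k _; rewrite IH.
set E := \sum_(k < n.+1) _; set S := \sum_j \sum_(k < n) _; set s := \sum_j _.
by move=> HW HV; rewrite !mulrBl !mul1r {1}HV {1}HW; ring.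
Qed.

(** For i <= 1 the numerator is 0, so the sum over i >= 2 of the closed
    formula may start at 0. *)
Definition collision_coef (i : nat) : R :=
  (-1) ^+ i * (i%:R - 1) * (1 - p jd ^+ i) / (1 - \sum_j p j ^+ i).

Lemma collision_coefM i : collision_coef i * (1 - \sum_j p j ^+ i) =
  (-1) ^+ i * (i%:R - 1) * (1 - p jd ^+ i).
Proof.
rewrite /collision_coef; case: i => [|[|i]].
- by rewrite expr0 subrr !mulr0 !mul0r.
- by rewrite subrr !mulr0 !mul0r.
by rewrite mulfVK // subr_eq0 eq_sym lt_eqF ?sum_pow_lt1.
Qed.

Lemma collision_coef_small i : (i <= 1)%N -> collision_coef i = 0.
Proof.
rewrite /collision_coef; case: i => [|[|//]] _.
  by rewrite expr0 subrr !mulr0 !mul0r.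
by rewrite subrr !mulr0 !mul0r.
Qed.

Definition collision_formula (n : nat) : R :=
  \sum_(i < n.+1) 'C(n, i)%:R * collision_coef i.

Lemma collision_formula_widen (n N : nat) : (n <= N)%N ->
  collision_formula n = \sum_(i < N.+1) 'C(n, i)%:R * collision_coef i.
Proof.
move=> leN; rewrite /collision_formula.
rewrite (big_ord_widen _ (fun i => 'C(n, i)%:R * collision_coef i) (leN : (n < N.+1)%N)).
rewrite big_mkcond; apply: eq_bigr => i _; case: ltnP => // ni.
by rewrite bin_small // mul0r.
Qed.

Lemma collision_formula_rec (n : nat) : (2 <= n)%N ->
  collision_formula n = collision_rec n collision_formula.
Proof.
move=> n2; rewrite collision_recE.
have -> : \sum_j \sum_(k < n.+1) 'C(n, k)%:R * p j ^+ k * (1 - p j) ^+ (n - k) *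
    collision_formula k = \sum_(i < n.+1) 'C(n, i)%:R * collision_coef i * \sum_j p j ^+ i.
  under [RHS]eq_bigr do rewrite mulr_sumr.
  rewrite [RHS]exchange_big /=; apply: eq_bigr => j _.
  transitivity (\sum_(k < n.+1) \sum_(i < n.+1) 'C(n, k)%:R * p j ^+ k * (1 - p j) ^+ (n - k) *
      'C(k, i)%:R * collision_coef i).
    apply: eq_bigr => -[k kn] _ /=; rewrite (collision_formula_widen (kn : (k <= n)%N)) mulr_sumr.
    by apply: eq_bigr => i _; rewrite mulrA.
  rewrite exchange_big /=; apply: eq_bigr => i _.
  by rewrite -mulr_suml binomial_moment mulrAC.
apply/eqP; rewrite -subr_eq; apply/eqP.
rewrite /collision_formula -sumrB.
transitivity (\sum_(i < n.+1) ('C(n, i)%:R * ((-1) ^+ i * (i%:R - 1) * 1 ^+ i) -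
    'C(n, i)%:R * ((-1) ^+ i * (i%:R - 1) * p jd ^+ i)) : R).
  apply: eq_bigr => i _; have := collision_coefM i; rewrite expr1n.
  move: (collision_coef i) (\sum_j _) ((-1) ^+ i * _) (p jd ^+ i) ('C(n, i)%:R : R).
  move=> al S s Y B H.
  by transitivity (B * (al * (1 - S))); [ring | rewrite H; ring].
case: n n2 => [|[|m]] // _; rewrite sumrB !alternating_bin_sum subrr !exprS !mul0r.
rewrite 2!big_ord_recl [X in _ = _ + (_ + X)]big1; last by move=> k _; rewrite /= mulr0.
rewrite /= bin0 bin1 subn0 subn1 /= expr0 expr1 !exprS.
move: ((1 - p jd) ^+ m) (m.+2%:R : R) => q M.
by ring.
Qed.

End linear_recursion.

(** * From generating functions to means *)

Section expectation.
Context (R : realType) (disp : measure_display)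
  (T : measurableType disp) (P : probability T R) (c : nat -> {RV P >-> nat}).

Definition rpgf (m : nat) (z : R) : R := \int[P]_t z ^+ c m t.

Lemma pgf_real (m : nat) (z : R) : pgf c m z%:C = (rpgf m z)%:C.
Proof.
rewrite /pgf /expectationC /rpgf.
have -> : \int[P]_t complex.Im (z%:C ^+ c m t) = 0.
  rewrite /Rintegral (_ : (fun t => _) = cst 0%E) ?integral0 //.
  by apply/funext => t /=; rewrite -rmorphXn.
have -> : \int[P]_t complex.Re (z%:C ^+ c m t) = \int[P]_t z ^+ c m t.
  by apply: eq_Rintegral => t _; rewrite -rmorphXn.
by [].
Qed.

Lemma norm_exp_le1 (z : R) (k : nat) : 0 <= z <= 1 -> `|z ^+ k| <= 1.
Proof.
by move=> /andP[z0 z1]; rewrite ger0_norm ?exprn_ge0 // exprn_ile1.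
Qed.

Lemma rpgf_ge0_le1 (m : nat) (z : R) : 0 <= z <= 1 -> 0 <= rpgf m z <= 1.
Proof.
move=> z01; apply/andP; split.
  by apply: Rintegral_ge0 => t _; rewrite exprn_ge0 //; case/andP: z01.
apply: le_trans (ler_norm _) _.
by apply: (@Rintegral_bounded _ _ _ P c m (fun k => z ^+ k)) => k; exact: norm_exp_le1.
Qed.

Lemma rpgf_recursion (d : nat) (hd : (2 <= d)%N) (p : 'I_d -> R)
    (jd : 'I_d) (hjd : jd.+1 = d) (n : nat) (z : R) : 0 <= z <= 1 ->
  (forall m, (m <= 1)%N -> {ae P, forall t, c m t = 0%N}) ->
  collision_identity p c n ->
  rpgf n z = \sum_(f : {ffun 'I_d -> 'I_n.+1}) multinomial_pmf p n (fun j => f j) *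
    (z ^+ (f jd <= 1)%N * \prod_j rpgf (f j) z).
Proof.
move=> z01 c01 cid; apply: complexI; rewrite -pgf_real.
rewrite (pgf_recursion hd hjd c01 cid); last first.
  move=> m; have z1 : `|z%:C| <= 1 :> R[i].
    by rewrite normr_complex normc_real -(rmorph1 (real_complex R)) lecR
       -[z]expr1 norm_exp_le1.
  by case: (@Rtilde_abs_cvg_disk _ _ _ _ c 0 _ z1).
rewrite rmorph_sum; apply: eq_bigr => f _; rewrite !rmorphM rmorphXn rmorph_prod.
by do 2 congr (_ * _); apply: eq_bigr => j _; exact: pgf_real.
Qed.

(** Points increasing to 1 from below, with node 0 = 0. *)
Definition node (r : nat) : R := 1 - harmonic r.

Lemma node01 r : 0 <= node r <= 1.
Proof.
rewrite /node subr_ge0 lerBlDr lerDl harmonic_ge0 andbT.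
by rewrite /harmonic /= invf_le1 ?ltr0n // ler1n.
Qed.

(** The difference quotient of the generating function between node r and 1. *)
Definition slope (m r : nat) : R := (1 - rpgf m (node r)) / harmonic r.

Lemma rpgf_slope m r : 1 - rpgf m (node r) = slope m r * harmonic r.
Proof. by rewrite /slope mulfVK // gt_eqF // harmonic_gt0. Qed.

Lemma geometric_slope k r :
  \sum_(i < k) node r ^+ i = (1 - node r ^+ k) / harmonic r.
Proof.
have h0 : harmonic r != 0 :> R by rewrite gt_eqF // harmonic_gt0.
apply: (mulIf h0); rewrite mulfVK //.
rewrite -[RHS]opprB subrX1 /node; ring.
Qed.

Lemma slopeE m r :
  (slope m r)%:E = (\int[P]_t (\sum_(i < c m t) node r ^+ i)%:E)%E.
Proof.
have iX : P.-integrable [set: T] (EFin \o (fun t => node r ^+ c m t)).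
  apply: (@integrable_bounded _ _ _ P c m (fun k => node r ^+ k) 1) => k.
  exact: norm_exp_le1 (node01 r).
have i1 : P.-integrable [set: T] (EFin \o (fun=> 1 : R)).
  exact: finite_measure_integrable_cst.
have i1X : P.-integrable [set: T] (EFin \o (fun t => 1 - node r ^+ c m t)).
  exact: (integrableB measurableT i1 iX).
transitivity (\int[P]_t ((1 - node r ^+ c m t) / harmonic r))%:E.
  rewrite RintegralZr // RintegralB // /slope /rpgf.
  have PT : P setT = 1%E by exact: probability_setT.
  by rewrite Rintegral_cst // [X in fine X]PT /= mulr1.
rewrite /Rintegral fineK; last first.
  apply: integrable_fin_num => //.
  apply: (@integrable_bounded _ _ _ P c m
    (fun k => (1 - node r ^+ k) / harmonic r) (2 / harmonic r)) => k.
  rewrite normrM (ger0_norm (_ : 0 <= (harmonic r)^-1)) ?invr_ge0 ?harmonic_ge0 //.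
  apply: ler_wpM2r; first by rewrite invr_ge0 harmonic_ge0.
  by rewrite (le_trans (ler_normB _ _)) // normr1 lerD2l norm_exp_le1 ?node01.
by apply: eq_integral => t _; rewrite geometric_slope.
Qed.

Lemma cvg_node : node @ \oo --> (1 : R).
Proof.
rewrite -[X in _ --> X](subr0 (1 : R)); apply: cvgB; first exact: cvg_cst.
exact: cvg_harmonic.
Qed.

(** The geometric sums below increase to c_m as the node tends to 1, and monotone
    convergence holds whether or not the mean is finite. *)
Lemma cvg_slope m : (slope m r)%:E @[r --> \oo] --> ('E_P[fun t => (c m t)%:R])%E.
Proof.
have nd k : {homo (fun r => \sum_(i < k) node r ^+ i : R) : r s / (r <= s)%N >-> r <= s}.
  move=> r s rs; apply: ler_sum => i _; apply: lerXn2r.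
  - by rewrite nnegrE; case/andP: (node01 r).
  - by rewrite nnegrE; case/andP: (node01 s).
  by rewrite /node lerD2l lerN2 /harmonic /= lef_pV2 ?posrE ?ltr0n // ler_nat ltnS.
have lim k : (\sum_(i < k) node r ^+ i : R) @[r --> \oo] --> (k%:R : R).
  have -> : k%:R = \sum_(i < k) (1 : R) ^+ i.
    by under eq_bigr do rewrite expr1n; rewrite sumr_const card_ord.
  apply: cvg_big => [|i _]; first exact: add_continuous.
  exact: (cvg_comp _ _ cvg_node (@exprn_continuous R i 1)).
have -> : 'E_P[fun t => (c m t)%:R]%E =
    (\int[P]_t limn (fun r => (\sum_(i < c m t) node r ^+ i)%:E))%E.
  rewrite unlock; apply: eq_integral => t _; apply/esym/cvg_lim => //.
  by apply: cvg_EFin; [exact: nearW | exact: lim].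
rewrite [X in X @ _ --> _](_ : _ = fun r =>
    (\int[P]_t (\sum_(i < c m t) node r ^+ i)%:E)%E); last first.
  by apply/funext => r; exact: slopeE.
apply: cvg_monotone_convergence => //.
- move=> r; exact: (measurable_fun_of_nat (c m) (fun k => \sum_(i < k) node r ^+ i)).
- move=> r t _; rewrite lee_fin sumr_ge0 // => i _; rewrite exprn_ge0 //.
  by case/andP: (node01 r).
- by move=> t _ r s rs; rewrite lee_fin; exact: nd.
Qed.

Lemma one_sub_prod_le (I : Type) (r : seq I) (u L : I -> R) :
  (forall i, 0 <= u i <= 1) -> (forall i, 1 - u i <= L i) ->
  0 <= \prod_(i <- r) u i <= 1 /\ 1 - \prod_(i <- r) u i <= \sum_(i <- r) L i.
Proof.
move=> u01 uL; elim/big_ind2: _ => [|K x L' y [/andP[x0 x1] xK] [/andP[y0 y1] yL]|i _] //.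
  by rewrite ler01 lexx subrr.
split; first by rewrite mulr_ge0 // mulr_ile1.
have : 0 <= (1 - x) * (1 - y) by rewrite mulr_ge0 // subr_ge0.
nra.
Qed.

(** The product rule at 1, where all factors have the value 1. *)
Lemma cvg_slope_prod (I : Type) (r : seq I) (u : I -> nat -> R) (L : I -> R) (h : nat -> R) :
  (forall i, u i @ \oo --> (1 : R)) ->
  (forall i, (fun n => (1 - u i n) / h n) @ \oo --> L i) ->
  (fun n => (1 - \prod_(i <- r) u i n) / h n) @ \oo --> \sum_(i <- r) L i.
Proof.
move=> u1 uL.
(* 1 - u v = (1 - u) + u (1 - v); the limit of the product itself is carried
   along the induction. *)
suff : (fun n => \prod_(i <- r) u i n) @ \oo --> (1 : R) /\
  (fun n => (1 - \prod_(i <- r) u i n) / h n) @ \oo --> \sum_(i <- r) L i by case.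
elim: r => [|i r [IH1 IH2]].
  split; under eq_fun do rewrite big_nil; first exact: cvg_cst.
  by rewrite big_nil; under eq_fun do rewrite subrr mul0r; exact: cvg_cst.
split; under eq_fun do rewrite big_cons.
  have : (fun n => u i n * \prod_(j <- r) u j n) @ \oo --> (1 * 1 : R).
    by apply: cvgM; [exact: u1 | exact: IH1].
  by rewrite mulr1.
rewrite big_cons.
have -> : (fun n => (1 - u i n * \prod_(j <- r) u j n) / h n) =
  (fun n => (1 - u i n) / h n + u i n * ((1 - \prod_(j <- r) u j n) / h n)).
  by apply/funext => n; ring.
apply: cvgD; first exact: uL.
have : (fun n => u i n * ((1 - \prod_(j <- r) u j n) / h n)) @ \oo -->
    (1 * \sum_(j <- r) L j : R) by apply: cvgM; [exact: u1 | exact: IH2].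
by rewrite mul1r.
Qed.

Section bounded.
Context (d : nat) (hd : (2 <= d)%N)
  (p : 'I_d -> R) (p_ge0 : forall j, 0 <= p j) (p_sum : \sum_(j < d) p j = 1)
  (p_neq1 : forall j, p j <> 1) (jd : 'I_d) (hjd : jd.+1 = d)
  (hc : sicta_collisions p c).

Lemma collisions01_ae0 m : (m <= 1)%N -> {ae P, forall t, c m t = 0%N}.
Proof. by have [c0 c1 _] := hc; case: m => [|[|]]. Qed.

Lemma slope01 m r : (m <= 1)%N -> slope m r = 0.
Proof.
move=> m1; rewrite /slope.
have -> : rpgf m (node r) = 1.
  by apply: complexI; rewrite -pgf_real pgf_ae0 //; exact: collisions01_ae0.
by rewrite subrr mul0r.
Qed.

Lemma slope_recursion n r : (2 <= n)%N ->
  slope n r = \sum_(f : {ffun 'I_d -> 'I_n.+1}) multinomial_pmf p n (fun j => f j) *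
    ((1 - node r ^+ (f jd <= 1)%N * \prod_j rpgf (f j) (node r)) / harmonic r).
Proof.
move=> n2; have [_ _ /(_ _ n2) cn] := hc.
rewrite /slope (rpgf_recursion hd hjd (node01 r) collisions01_ae0 cn).
rewrite -{1}(multinomial_total p_sum jd n) -sumrB mulr_suml.
by apply: eq_bigr => f _; rewrite [RHS]mulrA [in RHS]mulrBr mulr1.
Qed.

(** 1 - u_1 ... u_k is at most the sum of the 1 - u_i for numbers in [0, 1]. *)
Lemma slope_rec_le n r : (2 <= n)%N ->
  slope n r <= collision_rec p jd n (slope ^~ r).
Proof.
move=> n2; rewrite slope_recursion //; apply: ler_sum => f _.
apply: ler_wpM2l; first exact: multinomial_pmf_ge0.
have h0 := @harmonic_gt0 R r.
rewrite ler_pdivrMr // mulrDl mulr_suml.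
have le_slope j : 1 - rpgf (f j) (node r) <= slope (f j) r * harmonic r.
  by rewrite rpgf_slope.
have [/andP[u0 u1] uL] := one_sub_prod_le (index_enum 'I_d)
  (fun j => rpgf_ge0_le1 (f j) (node01 r)) le_slope.
set U := \prod_j _ in u0 u1 uL *; set S := \sum_j _ in uL *.
have /andP[z0 z1] := node01 r.
have zE : node r = 1 - harmonic r by [].
have zU : 0 <= (1 - node r) * (1 - U) by rewrite mulr_ge0 // subr_ge0.
move: (node r) (harmonic r) zE zU => z h zE zU.
by case: (f jd <= 1)%N => /=; rewrite ?expr1 ?expr0 ?mul0r ?add0r ?mul1r //; nra.
Qed.

(** By strong induction: the recursion bounds the slope at n by a constant plus
    p_1^n + ... + p_d^n times itself, and this coefficient is less than 1. *)
Lemma slope_bounded n : exists B, forall r, slope n r <= B.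
Proof.
elim/ltn_ind: n => n IH.
have [n1|n2] := leqP n 1; first by exists 0 => r; rewrite slope01.
have [B HB] : exists B : nat -> R, forall k, (k < n)%N -> forall r, slope k r <= B k.
  have /choice [B HB] : forall k, exists b, (k < n)%N -> forall r, slope k r <= b.
    move=> k; have [/IH [b Hb]|nk] := ltnP k n; first by exists b.
    by exists 0.
  by exists B.
have s1 : 0 < 1 - \sum_j p j ^+ n by rewrite subr_gt0; exact: sum_pow_lt1.
pose E := \sum_(k < n.+1) 'C(n, k)%:R * p jd ^+ k * (1 - p jd) ^+ (n - k) * (k <= 1)%N%:R
  + \sum_j \sum_(k < n) 'C(n, k)%:R * p j ^+ k * (1 - p j) ^+ (n - k) * B k.
exists (E / (1 - \sum_j p j ^+ n)) => r.
rewrite ler_pdivlMr // mulrBr mulr1 lerBlDr [X in _ + X]mulrC.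
apply: le_trans (slope_rec_le r n2) _; rewrite (collision_rec_recr p_sum) lerD2r lerD2l.
apply: ler_sum => j _; apply: ler_sum => k _; apply: ler_wpM2l; last exact: HB.
rewrite !mulr_ge0 ?ler0n ?exprn_ge0 // subr_ge0 ltW //; exact: cell_prob_lt1.
Qed.

Definition mean_collisions (n : nat) : R := fine ('E_P[fun t => (c n t)%:R])%E.

Lemma mean_collisionsE n : ('E_P[fun t => (c n t)%:R])%E = (mean_collisions n)%:E.
Proof.
rewrite /mean_collisions fineK //.
have [B HB] := slope_bounded n.
rewrite ge0_fin_numE; last first.
  by rewrite unlock; apply: integral_ge0 => t _; rewrite lee_fin.
apply: le_lt_trans (ltry B); rewrite -(cvg_lim _ (@cvg_slope n)) //.
apply: lime_le; first by apply/cvg_ex; eexists; exact: (@cvg_slope n).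
by apply: nearW => r; rewrite lee_fin.
Qed.

Lemma cvg_slope_mean n : slope n @ \oo --> mean_collisions n.
Proof.
by have := @cvg_slope n; rewrite mean_collisionsE => H; exact: (fine_cvg H).
Qed.

(** Divide 1 - (product recursion) by the step and let the step tend to 0.  The
    factor z^e is handled by the product rule as one more factor, indexed by
    [None]. *)
Lemma mean_collisions_rec n : (2 <= n)%N ->
  mean_collisions n = collision_rec p jd n mean_collisions.
Proof.
move=> n2.
suff cv : slope n @ \oo --> collision_rec p jd n mean_collisions.
  exact: (cvg_unique (@Rhausdorff R) (@cvg_slope_mean n) cv).
have u1 m : (fun r => rpgf m (node r)) @ \oo --> (1 : R).
  have -> : (fun r => rpgf m (node r)) = (fun r => 1 - slope m r * harmonic r).
    by apply/funext => r; rewrite -rpgf_slope subKr.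
  rewrite -[X in _ --> X](subr0 (1 : R)) -(mulr0 (mean_collisions m)).
  apply: cvgB; first exact: cvg_cst.
  by apply: cvgM; [exact: cvg_slope_mean | exact: cvg_harmonic].
rewrite [X in X @ _ --> _](_ : _ = fun r =>
  \sum_(f : {ffun 'I_d -> 'I_n.+1}) multinomial_pmf p n (fun j => f j) *
    ((1 - node r ^+ (f jd <= 1)%N * \prod_j rpgf (f j) (node r)) / harmonic r)); last first.
  by apply/funext => r; exact: slope_recursion.
apply: cvg_big => [|f _]; first exact: add_continuous.
apply: cvgM; first exact: cvg_cst.
pose u (o : option 'I_d) r := if o is Some j then rpgf (f j) (node r)
  else node r ^+ (f jd <= 1)%N.
pose L (o : option 'I_d) := if o is Some j then mean_collisions (f j)
  else (f jd <= 1)%N%:R.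
have u1o o : u o @ \oo --> (1 : R).
  case: o => [j|]; rewrite /u; first exact: u1.
  by case: (f jd <= 1)%N; [exact: cvg_node | exact: cvg_cst].
have uL o : (fun r => (1 - u o r) / harmonic r) @ \oo --> L o.
  case: o => [j|]; rewrite /u /L; first exact: cvg_slope_mean.
  apply: cvg_near_cst; apply: nearW => r.
  have h0 : harmonic r != 0 :> R by rewrite gt_eqF // harmonic_gt0.
  by case: (f jd <= 1)%N; rewrite ?expr1 ?expr0 /node ?subKr ?divff // subrr mul0r.
have := @cvg_slope_prod _ (None :: map Some (index_enum 'I_d)) u L (@harmonic R) u1o uL.
rewrite big_cons big_map.
rewrite [X in X @ _ --> _ -> _](_ : _ = fun r =>
  (1 - node r ^+ (f jd <= 1)%N * \prod_j rpgf (f j) (node r)) / harmonic r) //.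
by apply/funext => r; rewrite big_cons big_map.
Qed.

Lemma mean_collisions_formula n : mean_collisions n = collision_formula p jd n.
Proof.
apply: (collision_rec_unique p_ge0 p_sum p_neq1 (jd := jd)) => {}n.
- move=> n1; rewrite /collision_formula big1; last first.
    move=> i _; rewrite collision_coef_small ?mulr0 //.
    by rewrite (leq_trans _ n1) // -ltnS.
  have slope0 : slope n @ \oo --> (0 : R).
    by apply: cvg_near_cst; apply: nearW => r; exact: slope01.
  exact: (cvg_unique (@Rhausdorff R) (@cvg_slope_mean n) slope0).
- exact: mean_collisions_rec.
- exact: collision_formula_rec.
Qed.

End bounded.
End expectation.

Lemma collision_formulaE (R : realType) (d : nat) (p : 'I_d -> R) (jd : 'I_d)
    (n : nat) :
  collision_formula p jd n =
  \sum_(2 <= i < n.+1) 'C(n, i)%:R * collision_coef p jd i.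
Proof.
rewrite /collision_formula -(big_mkord xpredT (fun i => 'C(n, i)%:R * collision_coef p jd i)).
have small m : (m <= 2)%N ->
    \sum_(0 <= i < m) 'C(n, i)%:R * collision_coef p jd i = 0.
  move=> m2; rewrite big_nat big1 // => i im.
  by rewrite collision_coef_small ?mulr0 //; lia.
have [n2|n2] := leqP 2 n.+1; first by rewrite (big_cat_nat (n := 2)) //= small // add0r.
by rewrite small ?(ltnW n2) // [RHS]big_geq // ltnW.
Qed.

Theorem mainTheorem6 (R : realType) (d : nat) (hd : (2 <= d)%N)
  (p : 'I_d -> R) (p_ge0 : forall j, 0 <= p j) (p_sum : \sum_(j < d) p j = 1)
  (p_neq1 : forall j, p j <> 1) (jd : 'I_d) (hjd : jd.+1 = d)
  (disp : measure_display) (T : measurableType disp) (P : probability T R)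
  (c : nat -> {RV P >-> nat}) (hc : sicta_collisions p c) :
  [/\ forall x z : R[i], `|z| <= 1 -> Rtilde_abs_cvg c x z,
      forall x z : R[i], Rtilde_abs_cvg c x z ->
        Rtilde c x z =
          (1 + x) * (1 - z)
          + (z - 1) * (x * (p jd)%:C + 1)
            * \prod_(i < d | i != jd) Rtilde c ((p i)%:C * x) z
          + \prod_(j < d) Rtilde c ((p j)%:C * x) z
    & forall n : nat,
        ('E_P[fun t => (c n t)%:R])%E =
        (\sum_(2 <= i < n.+1)
           'C(n, i)%:R * ((-1) ^+ i * (i%:R - 1) * (1 - p jd ^+ i)
                          / (1 - \sum_(j < d) p j ^+ i)))%:E ].
Proof.
split.
- by move=> x z; exact: Rtilde_abs_cvg_disk.
- by move=> x z; exact: (Rtilde_functional hd p_ge0 p_sum hjd hc).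
move=> n; rewrite (mean_collisionsE hd p_ge0 p_sum p_neq1 hjd hc).
rewrite (mean_collisions_formula hd p_ge0 p_sum p_neq1 hjd hc) collision_formulaE.
by congr EFin.
Qed.
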